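(* Let $\alpha,\beta>0$ with $\alpha+\beta<\pi$ be trigonometrically rational angles, i.e. $\sin\alpha,\cos\alpha,\sin\beta,\cos\beta$ are rational numbers. Then the growth of the combinatorial complexity function $N_c(n)$ of the billiard in the triangle with interior angles $(\alpha,\beta,\pi-\alpha-\beta)$ is weakly exponential: for every $\varepsilon>0$ there is a constant $C>0$ such that $N_c(n)<Ce^{n^{\varepsilon}}$ for all $n\in\mathbb{N}$.
   Context: Billiard in a polygon $Q$: a point mass moves in $Q$ along a straight line until it hits $\partial Q$; on hitting a side it reflects so that the angle of incidence equals the angle of reflection, and continues along the new line; if it hits a vertex, its future motion is not defined. A generalized diagonal is an oriented billiard trajectory that starts and terminates at a vertex (not necessarily the same one). The sides of $Q$ are not counted as generalized diagonals. The combinatorial length $\ell_c(\gamma)$ of a generalized diagonal $\gamma$ is the number of its reflections off sides. The combinatorial complexity function is $N_c(n)=\#\{\gamma : \gamma \text{ a generalized diagonal},\ \ell_c(\gamma)\le n\}$, $n\in\mathbb{N}$; by convention the vertices of $Q$ are also counted, as generalized diagonals of combinatorial length $0$. An angle $\theta$ is trigonometrically rational if $\sin\theta$ and $\cos\theta$ are rational numbers. (The functions considered depend only on the triangle up to similarity, so only on its angles.) *)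

(* Defs.v *)
From HB Require Import structures.
From mathcomp Require Export all_boot all_order all_algebra.
From mathcomp Require Export all_classical all_reals all_analysis.
Export numFieldNormedType.Exports.

Set Implicit Arguments.
Unset Strict Implicit.
Unset Printing Implicit Defensive.

Import Order.TTheory GRing.Theory Num.Theory.

Local Open Scope classical_set_scope.
Local Open Scope ring_scope.

Section Billiard.
Variable R : realType.

(* The library norm on 'rV[R]_2 is the sup norm, hence an explicit Euclidean
   norm. *)
Definition dot (u v : 'rV[R]_2) : R := \sum_i u 0 i * v 0 i.

Definition euclid_norm (u : 'rV[R]_2) : R := Num.sqrt (dot u u).

(* The unoriented angle at [p], in [0, pi], between the rays towards [x] and
   [y]; meaningful for [x] and [y] different from [p]. *)
Definition angle (x p y : 'rV[R]_2) : R :=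
  acos (dot (x - p) (y - p) / (euclid_norm (x - p) * euclid_norm (y - p))).

Definition open_segment (x y : 'rV[R]_2) : set 'rV[R]_2 :=
  [set z | exists t : R, 0 < t < 1 /\ z = (1 - t) *: x + t *: y].

(* Triangles are given by their vertices. Indices in 'I_3 are taken modulo 3,
   so [P i], [P (i + 1)], [P (i + 2)] are the three vertices. *)
Definition nondegenerate (P : 'I_3 -> 'rV[R]_2) : Prop :=
  row_free (col_mx (P 1 - P 0) (P 2 - P 0)).

Definition interior_angle (P : 'I_3 -> 'rV[R]_2) (i : 'I_3) : R :=
  angle (P (i + 1)) (P i) (P (i + 2)).

Definition has_angles (P : 'I_3 -> 'rV[R]_2) (a b c : R) : Prop :=
  [/\ nondegenerate P, interior_angle P 0 = a, interior_angle P 1 = b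
    & interior_angle P 2 = c].

Definition open_triangle (P : 'I_3 -> 'rV[R]_2) : set 'rV[R]_2 :=
  [set x | exists a : 'I_3 -> R,
    [/\ forall i, 0 < a i, \sum_i a i = 1 & x = \sum_i a i *: P i]].

(* The side opposite to the vertex [P i], without its endpoints. *)
Definition open_side (P : 'I_3 -> 'rV[R]_2) (i : 'I_3) : set 'rV[R]_2 :=
  open_segment (P (i + 1)) (P (i + 2)).

(* A point mass coming from [x] and hitting a side at [p] continues towards
   [y]: the angle between the incoming leg and one end of the side equals the
   angle between the outgoing leg and the other end. When both legs lie inside
   the triangle this determines the direction of the outgoing leg. *)
Definition reflects (P : 'I_3 -> 'rV[R]_2) (x p y : 'rV[R]_2) : Prop :=
  exists2 i, open_side P i p &
    angle x p (P (i + 1)) = angle y p (P (i + 2)).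

(* A generalized diagonal is encoded by the sequence of its starting vertex,
   its successive reflection points and its terminal vertex. The legs lie in
   the open triangle, which excludes the sides, and the reflection points are
   never vertices. *)
Definition generalized_diagonal (P : 'I_3 -> 'rV[R]_2) (s : seq 'rV[R]_2)
    : Prop :=
  [/\ (2 <= size s)%N,
      exists i, s`_0 = P i,
      exists i, s`_(size s).-1 = P i,
      forall k, (k.+1 < size s)%N ->
        open_segment s`_k s`_k.+1 `<=` open_triangle P
    & forall k, (k.+2 < size s)%N -> reflects P s`_k s`_k.+1 s`_k.+2].

Definition vertex_diagonal (P : 'I_3 -> 'rV[R]_2) (s : seq 'rV[R]_2) : Prop :=
  exists i, s = [:: P i].

(* The number of reflections; truncated subtraction gives 0 for the
   one-point sequences that encode vertices. *)
Definition combinatorial_length (s : seq 'rV[R]_2) : nat := (size s - 2)%N.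

(* [counting] is +oo on infinite sets, so that an upper bound on the
   complexity includes its finiteness. *)
Definition combinatorial_complexity (P : 'I_3 -> 'rV[R]_2) (n : nat)
    : \bar R :=
  counting [set s : seq 'rV[R]_2 |
    (vertex_diagonal P s \/ generalized_diagonal P s) /\
    (combinatorial_length s <= n)%N].

Definition trig_rational (theta : R) : Prop :=
  range (@ratr R) (sin theta) /\ range (@ratr R) (cos theta).

Definition weakly_exponential (f : nat -> \bar R) : Prop :=
  forall eps : R, 0 < eps ->
    exists2 C : R, 0 < C &
      forall n : nat, (f n < (C * expR (n%:R `^ eps))%:E)%E.

End Billiard.

(* Main.v *)
(** Unfolded along the word of the sides it crosses, a generalized diagonal is a
    straight segment between two vertices, determined by its word; let [N n] be
    the number of these words of length at most [n].  A cone of directions at a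
    vertex splits when a vertex of the unfolding enters it, and the vector
    joining two consecutive splitting vertices is a side or a generalized
    diagonal of a copy of the triangle, of length less than the elapsed time.
    Let [Y] be the set of directions of the generalized diagonals of length at
    most [m] in the copies of the triangle reached in time [2 * m].  The linear
    parts of the unfolding maps take polynomially many values, so [Y] has at
    most [poly m * (N m + 9)] elements.  A cone that is much narrower than its
    distance to [Y] splits at most once every [m] steps, hence contains at most
    four diagonals of length at most [2 * m].  Since the sines and cosines are
    rational, barycentric coordinates of the unfolded vertices have denominators
    dividing [D ^ n], so a diagonal whose direction is not in [Y] stays at
    distance at least [exp (- O(m))] from [Y].  Covering the directions by narrow
    cones at logarithmic distances from [Y] gives
    [N (2 * m) + 9 <= C * m ^ 8 * (N m + 9)], hence [N n <= n ^ (O (log n))]. *)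
Require Import Defs.
From mathcomp Require Import zify ring lra.

Set Implicit Arguments.
Unset Strict Implicit.
Unset Printing Implicit Defensive.

Import Order.TTheory GRing.Theory Num.Theory.

Local Open Scope ring_scope.

(** * Unfolding the triangle *)

(** The separation from [Y] is exponentially small, but cones whose width is proportional to their
    distance to [Y] grow geometrically, so its logarithm alone counts. The ratio of width to
    distance must be of order [1 / m]: two tips in a cone of width [w] are at distance O(m) from the
    base vertex and their difference is bounded below, so that difference is directed within O(m *
    w) of the cone, and this must not reach [Y]. With O(m) scales this makes O(m ^ 2) cones per
    element of [Y]. The other factor [m ^ 6] counts linear parts: a composition of reflections
    depends only on its parity and on signed multiplicities of three fixed angles. Directions are
    measured by the point where the line meets the opposite side, not by an angle, so that the
    slopes to be separated are rational. *)

Lemma I3_cases (i j : 'I_3) : [\/ j = i, j = i + 1 | j = i + 2].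
Proof.
have : [|| j == i, j == i + 1 | j == i + 2].
  by case: i j => [[|[|[|?]]] ?] [[|[|[|?]]] ?].
by case/or3P => /eqP; [constructor 1|constructor 2|constructor 3].
Qed.

Lemma I3_arith (i : 'I_3) :
  (((i + 1 + 1)%R = (i + 2)%R) * ((i + 1 + 2)%R = i) * ((i + 2 + 1)%R = i) *
   ((i + 2 + 2)%R = (i + 1)%R))%type.
Proof.
have : [&& i + 1 + 1 == i + 2, i + 1 + 2 == i, i + 2 + 1 == i & i + 2 + 2 == i + 1].
  by case: i => [[|[|[|?]]] ?].
by case/and4P => /eqP -> /eqP -> /eqP -> /eqP ->.
Qed.

Lemma I3_neq (i : 'I_3) :
  (((i + 1 == i)%R = false) * ((i + 2 == i)%R = false) *
   ((i + 1 == i + 2)%R = false))%type.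
Proof. by case: i => [[|[|[|?]]] ?]. Qed.

Lemma seq_meet (A : eqType) (s t : seq A) :
  [\/ exists r, t = s ++ r, exists r, s = t ++ r |
      exists u x y s' t', [/\ x != y, s = u ++ x :: s' & t = u ++ y :: t']].
Proof.
elim: s t => [|x s IH] [|y t]; [by constructor 1; exists [::]|
  by constructor 1; exists (y :: t) | by constructor 2; exists (x :: s) |].
have [<-|xy] := eqVneq x y; last first.
  by constructor 3; exists [::], x, y, s, t.
case: (IH t) => [[r ->]|[r ->]|[u [a [b [s' [t' [ab -> ->]]]]]]].
- by constructor 1; exists r.
- by constructor 2; exists r.
- by constructor 3; exists (x :: u), a, b, s', t'.
Qed.

Section Unfolding.
Variable R : realFieldType.
Local Notation V := 'rV[R]_2.
Implicit Types (u v d O B : V) (T : 'I_3 -> V) (i j k : 'I_3)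
  (w r : seq 'I_3).

Definition cross u v : R := u 0 0 * v 0 1 - u 0 1 * v 0 0.

Definition area T : R := cross (T 1 - T 0) (T 2 - T 0).

Variable h : 'I_3 -> R.

(** When [h i] locates the foot of the altitude from [T i] in barycentric coordinates, this is the
    mirror image of [T i] in the opposite side. All copies of the triangle share these coordinates,
    so unfolding is an affine recursion with constant coefficients. *)
Definition flip i T j : V :=
  if j == i then
    (2 * h i) *: T (i + 1) + (2 * (1 - h i)) *: T (i + 2) - T i
  else T j.

Definition unfold T w : 'I_3 -> V := foldl (fun T i => flip i T) T w.

(* A word lists the sides crossed by an unfolded generalized diagonal. It
   determines the diagonal, which starts at the vertex opposite to the first
   side and ends at the vertex opposite to the last one. *)
Definition tip T w : V := unfold T w (last 0 w).

(* The line through [O] directed by [d] leaves [T] through its side [i]; the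
   factor [area T] takes care of the two orientations of [T]. *)
Definition gate O d T i : bool :=
  (area T * cross d (T (i + 1) - O) < 0) &&
  (0 < area T * cross d (T (i + 2) - O)).

Fixpoint crosses O d T w : bool :=
  if w is i :: w' then gate O d T i && crosses O d (flip i T) w' else true.

Definition diagonal T w : bool :=
  (w != [::]) && crosses (T (head 0 w)) (tip T w - T (head 0 w)) T w.

Lemma areaE T i : area T = cross (T (i + 1) - T i) (T (i + 2) - T i).
Proof.
have [->|->|->] := I3_cases 0 i.
- by rewrite /area !add0r.
- rewrite add0r /area /cross.
  have -> : (1 + 1 : 'I_3) = 2 by apply/val_inj.
  have -> : (1 + 2 : 'I_3) = 0 by apply/val_inj.
  rewrite !mxE; ring.
- rewrite add0r /area /cross.
  have -> : (2 + 1 : 'I_3) = 0 by apply/val_inj.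
  have -> : (2 + 2 : 'I_3) = 1 by apply/val_inj.
  rewrite !mxE; ring.
Qed.

Lemma flip_same i T :
  flip i T i = (2 * h i) *: T (i + 1) + (2 * (1 - h i)) *: T (i + 2) - T i.
Proof. by rewrite /flip eqxx. Qed.

Lemma flip_neq i j T : j != i -> flip i T j = T j.
Proof. by rewrite /flip => /negbTE ->. Qed.

Lemma flip1 i T : flip i T (i + 1) = T (i + 1).
Proof. by rewrite flip_neq ?I3_neq. Qed.

Lemma flip2 i T : flip i T (i + 2) = T (i + 2).
Proof. by rewrite flip_neq ?I3_neq. Qed.

Lemma area_flip i T : area (flip i T) = - area T.
Proof.
rewrite !(areaE _ i) flip_same flip1 flip2 /cross !mxE; ring.
Qed.

Lemma area_unfold T w : area (unfold T w) = (-1) ^+ size w * area T.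
Proof.
elim: w T => [|i w IH] T /=; first by rewrite mul1r.
by rewrite [LHS]IH area_flip exprS; ring.
Qed.

Lemma unfold_cat T w r : unfold T (w ++ r) = unfold (unfold T w) r.
Proof. exact: foldl_cat. Qed.

Lemma tip_cat T w i r : tip T (w ++ i :: r) = tip (unfold T w) (i :: r).
Proof. by rewrite /tip unfold_cat last_cat. Qed.

Lemma crosses_cat O d T w r :
  crosses O d T (w ++ r) = crosses O d T w && crosses O d (unfold T w) r.
Proof. by elim: w T => //= i w IH T; rewrite IH andbA. Qed.

(** The right and left ends of the side [i], as seen from the vertex [T i], whatever the orientation
    of [T]. *)
Definition gR T i := if 0 < area T then T (i + 1) else T (i + 2).
Definition gL T i := if 0 < area T then T (i + 2) else T (i + 1).

Lemma gateE O d T i : area T != 0 ->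
  gate O d T i =
    (cross d (gR T i - O) < 0) && (0 < cross d (gL T i - O)).
Proof.
move=> T0; rewrite /gate /gR /gL; case: (ltP 0 (area T)) => H.
  by rewrite pmulr_rlt0 // pmulr_rgt0.
have {}H : area T < 0 by rewrite lt_neqAle T0.
by rewrite nmulr_rlt0 // nmulr_rgt0 // andbC.
Qed.

Lemma gate_area T i : cross (gR T i - T i) (gL T i - T i) = `|area T|.
Proof.
rewrite /gR /gL; case: (ltP 0 (area T)) => H.
  by rewrite gtr0_norm // -areaE.
rewrite ler0_norm // (areaE _ i) /cross; ring.
Qed.

Lemma apex_area T i :
  cross (gR T i - flip i T i) (gL T i - flip i T i) = - `|area T|.
Proof.
rewrite flip_same /gR /gL; case: (ltP 0 (area T)) => H.
  rewrite gtr0_norm // (areaE _ i) /cross !mxE; ring.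
rewrite ler0_norm // (areaE _ i) /cross !mxE; ring.
Qed.

Lemma gate_next T i k : area T != 0 -> k != i ->
  gR (flip i T) k = gR T i /\ gL (flip i T) k = flip i T i \/
  gR (flip i T) k = flip i T i /\ gL (flip i T) k = gL T i.
Proof.
move=> T0; have [->|->|->] := I3_cases i k; first by rewrite eqxx.
- move=> _; rewrite /gR /gL area_flip oppr_gt0 !I3_arith flip2.
  by case: (ltgtP (area T) 0) T0 => // _ _; (by left) || (by right).
- move=> _; rewrite /gR /gL area_flip oppr_gt0 !I3_arith flip1.
  by case: (ltgtP (area T) 0) T0 => // _ _; (by left) || (by right).
Qed.

Lemma gate_same T i : area T != 0 ->
  gR (flip i T) i = gL T i /\ gL (flip i T) i = gR T i.
Proof.
move=> T0; rewrite /gR /gL area_flip oppr_gt0 flip1 flip2.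
by case: (ltgtP (area T) 0) T0.
Qed.

Lemma gate_next_neq O d T i k : area T != 0 ->
  gate O d T i -> gate O d (flip i T) k -> k != i.
Proof.
move=> T0; rewrite !gateE ?area_flip ?oppr_eq0 //.
move=> /andP[a b] /andP[c e]; apply/eqP => ki; move: c e.
by rewrite ki; have [-> ->] := gate_same i T0; rewrite ltNge ltW.
Qed.

Lemma two_exits T i k1 k2 : area T != 0 -> k1 != i -> k2 != i -> k1 != k2 ->
  [/\ gR (flip i T) k1 = gR T i, gL (flip i T) k1 = flip i T i,
      gR (flip i T) k2 = flip i T i & gL (flip i T) k2 = gL T i] \/
  [/\ gR (flip i T) k2 = gR T i, gL (flip i T) k2 = flip i T i,
      gR (flip i T) k1 = flip i T i & gL (flip i T) k1 = gL T i].
Proof.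
move=> T0; have [->|->|->] := I3_cases i k1; rewrite ?eqxx //;
have [->|->|->] := I3_cases i k2; rewrite ?eqxx // => _ _ _;
rewrite /gR /gL area_flip oppr_gt0 !I3_arith flip1 flip2;
by case: (ltgtP (area T) 0) T0 => // _; (by left) || (by right).
Qed.

(* [front B T i]: the gate [i] of [T] is crossed at a positive time by the rays
   from [B] through it. *)
Definition front B T i : bool := 0 < cross (gR T i - B) (gL T i - B).

(** [B] lies beyond the gate; meant for [B] the end point of a diagonal, as [front] is for a
    starting point. *)
Definition far B T i : bool := cross (gR T i - B) (gL T i - B) < 0.

(** Only the right inequality is weak: a ray that has met a vertex may have this vertex as the right
    end of the following gates. The left case is reduced to this one by a mirror image. *)
Definition wgate B d T i : bool :=
  (cross d (gR T i - B) <= 0) && (0 < cross d (gL T i - B)).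

Fixpoint wcrosses B d T w : bool :=
  if w is i :: w' then wgate B d T i && wcrosses B d (flip i T) w' else true.

Lemma gate_wgate B d T i : area T != 0 -> gate B d T i -> wgate B d T i.
Proof. by move=> T0; rewrite gateE // /wgate => /andP[/ltW -> ->]. Qed.

(* The time at which the ray from the origin in direction [d] meets the line
   through [r] and [l] is [cross r l / (cross d l - cross d r)]; these two
   identities compare the times for consecutive gates. *)
Lemma crossing_time_left d (r l v : V) :
  (cross d l - cross d r) * cross r v =
  (cross d v - cross d r) * cross r l
  - cross d r * (cross r v + cross v l - cross r l).
Proof. rewrite /cross; ring. Qed.

Lemma crossing_time_right d (r l v : V) :
  (cross d l - cross d r) * cross v l =
  (cross d l - cross d v) * cross r l
  + cross d l * (cross r v + cross v l - cross r l).
Proof. rewrite /cross; ring. Qed.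

(** The last factor in the two identities above is an area, so it does not depend on the base point
    and its sign is known. *)
Lemma apex_area_base B T i (v := flip i T i - B) :
  cross (gR T i - B) v + cross v (gL T i - B)
    - cross (gR T i - B) (gL T i - B) = `|area T|.
Proof.
apply: oppr_inj; rewrite -(apex_area T i) /v /cross !mxE; ring.
Qed.

(** Crossing times do not decrease from one gate to the next, so a positive time stays positive. *)
Lemma front_step B d T i k : area T != 0 -> k != i ->
  wgate B d T i -> wgate B d (flip i T) k -> front B T i ->
  front B (flip i T) k.
Proof.
move=> T0 ki; rewrite /wgate /front => /andP[xr xl].
have A0 : 0 < `|area T| by rewrite normr_gt0.
have dlt : 0 < cross d (gL T i - B) - cross d (gR T i - B) by lra.
have [[-> ->]|[-> ->]] := gate_next T0 ki => /andP[xr' xl'] rl.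
- rewrite -(pmulr_rgt0 _ dlt) crossing_time_left apex_area_base.
  have : 0 <= - cross d (gR T i - B) * `|area T| by apply: mulr_ge0; lra.
  have : 0 < (cross d (flip i T i - B) - cross d (gR T i - B))
    * cross (gR T i - B) (gL T i - B) by apply: mulr_gt0; lra.
  lra.
- rewrite -(pmulr_rgt0 _ dlt) crossing_time_right apex_area_base.
  have : 0 < cross d (gL T i - B) * `|area T| by apply: mulr_gt0; lra.
  have : 0 < (cross d (gL T i - B) - cross d (flip i T i - B))
    * cross (gR T i - B) (gL T i - B) by apply: mulr_gt0; lra.
  lra.
Qed.

Lemma far_step B d T i k : area T != 0 -> k != i ->
  gate B d T i -> gate B d (flip i T) k -> far B (flip i T) k ->
  far B T i.
Proof.
move=> T0 ki; rewrite !gateE ?area_flip ?oppr_eq0 // /far => /andP[xr xl].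
have A0 : 0 < `|area T| by rewrite normr_gt0.
have [[-> ->]|[-> ->]] := gate_next T0 ki => /andP[xr' xl'] rl.
- have dlt : 0 < cross d (flip i T i - B) - cross d (gR T i - B) by lra.
  have := crossing_time_left d (gR T i - B) (gL T i - B) (flip i T i - B).
  rewrite apex_area_base => E.
  have : 0 < - cross d (gR T i - B) * `|area T| by apply: mulr_gt0; lra.
  have : (cross d (gL T i - B) - cross d (gR T i - B))
    * cross (gR T i - B) (flip i T i - B) < 0 by rewrite pmulr_rlt0 //; lra.
  by move=> H1 H2; rewrite -(pmulr_rlt0 _ dlt); lra.
- have dlt : 0 < cross d (gL T i - B) - cross d (flip i T i - B) by lra.
  have := crossing_time_right d (gR T i - B) (gL T i - B) (flip i T i - B).
  rewrite apex_area_base => E.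
  have : 0 < cross d (gL T i - B) * `|area T| by apply: mulr_gt0; lra.
  have : (cross d (gL T i - B) - cross d (gR T i - B))
    * cross (flip i T i - B) (gL T i - B) < 0 by rewrite pmulr_rlt0 //; lra.
  by move=> H1 H2; rewrite -(pmulr_rlt0 _ dlt); lra.
Qed.

(** Backward induction: the apex lies beyond the last gate, and the times measured from it decrease
    towards earlier gates, so they stay negative. *)
Lemma far_tip T d i w : area T != 0 ->
  crosses (tip T (i :: w)) d T (i :: w) -> far (tip T (i :: w)) T i.
Proof.
elim: w T i => [|k w IH] T i T0 /=.
  by move=> _; rewrite /far /tip /= apex_area oppr_lt0 normr_gt0.
move=> /and3P[g1 g2 c].
have ki := gate_next_neq T0 g1 g2.
apply: (far_step T0 ki g1 g2).
have -> : tip T [:: i, k & w] = tip (flip i T) (k :: w) by [].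
by apply: IH; rewrite ?area_flip ?oppr_eq0 //= g2.
Qed.

Lemma crosses_wcrosses O d T w : area T != 0 ->
  crosses O d T w -> wcrosses O d T w.
Proof.
elim: w T => //= i w IH T T0 /andP[g c]; rewrite gate_wgate //=.
by rewrite IH ?area_flip ?oppr_eq0.
Qed.

Lemma crosses_cone O d1 d2 (a b : R) T w : area T != 0 -> 0 <= a -> 0 < b ->
  wcrosses O d1 T w -> crosses O d2 T w -> crosses O (a *: d1 + b *: d2) T w.
Proof.
move=> + a0 b0; elim: w T => //= i w IH T T0 /andP[g1 c1] /andP[g2 c2].
rewrite IH ?area_flip ?oppr_eq0 // andbT.
move: g1 g2; rewrite /wgate !gateE // => /andP[x1 x2] /andP[y1 y2].
have E v : cross (a *: d1 + b *: d2) v = a * cross d1 v + b * cross d2 v.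
  by rewrite /cross !mxE; ring.
rewrite !E; apply/andP; split.
- have : 0 <= a * - cross d1 (gR T i - O) by apply: mulr_ge0 => //; lra.
  have : 0 < b * - cross d2 (gR T i - O) by apply: mulr_gt0 => //; lra.
  lra.
- have : 0 <= a * cross d1 (gL T i - O) by apply: mulr_ge0 => //; lra.
  have : 0 < b * cross d2 (gL T i - O) by apply: mulr_gt0 => //; lra.
  lra.
Qed.

(* An affine map acting on areas by a non-zero factor maps crossings to
   crossings; reversing the orientation exchanges left and right twice. *)
Lemma crosses_map (f : V -> V) (e : R) O O' d T T' w :
  (forall (a b : R) u v, f (a *: u + b *: v) = a *: f u + b *: f v) ->
  e != 0 -> (forall u v, cross (f u) (f v) = e * cross u v) ->
  (forall j, T' j - O' = f (T j - O)) ->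
  crosses O' (f d) T' w = crosses O d T w.
Proof.
move=> fL e0 fc; elim: w T T' => //= i w IH T T' TT'.
have fB u v : f (u - v) = f u - f v.
  by have := fL 1 (-1) u v; rewrite !scale1r !scaleN1r.
congr (_ && _).
  have TB j k : T' j - T' k = f (T j - T k).
    have -> : T j - T k = (T j - O) - (T k - O) by rewrite opprB addrA subrK.
    by rewrite fB -!TT' opprB addrA subrK.
  have aE : area T' = e * area T by rewrite /area !TB fc.
  rewrite /gate !TT' !fc aE.
  have e2 : 0 < e ^+ 2 by rewrite lt_neqAle sqr_ge0 eq_sym sqrf_eq0 e0.
  have E x y : e * x * (e * y) = e ^+ 2 * (x * y) by ring.
  by rewrite !E pmulr_rlt0 // pmulr_rgt0.
apply: IH => j; rewrite /flip; case: ifP => // _.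
have -> : (2 * h i) *: T' (i + 1) + (2 * (1 - h i)) *: T' (i + 2) - T' i - O'
  = (2 * h i) *: (T' (i + 1) - O') + (2 * (1 - h i)) *: (T' (i + 2) - O')
    - (T' i - O').
  by apply/rowP => z; rewrite !mxE; ring.
rewrite !TT' -fL -fB; congr f.
by apply/rowP => z; rewrite !mxE; ring.
Qed.

(** * Vertices between two rays, and diagonals with nested words *)

Lemma cross_between (p q v : V) : 0 < cross p q -> 0 < cross p v ->
  cross q v < 0 ->
  exists a b : R, [/\ 0 < a, 0 < b & v = a *: p + b *: q].
Proof.
move=> pq pv qv; exists (cross v q / cross p q), (cross p v / cross p q).
split.
- by rewrite divr_gt0 //; move: qv; rewrite /cross; lra.
- by rewrite divr_gt0.
have pq0 : cross p q != 0 by rewrite gt_eqF.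
apply/rowP => z; rewrite !mxE.
have E x : x * cross p q =
   cross v q * p 0 z + cross p v * q 0 z -> 
   x = cross v q / cross p q * p 0 z + cross p v / cross p q * q 0 z.
  by move=> Ex; apply: (mulIf pq0); rewrite Ex; field.
apply: E; rewrite /cross.
have [->|->] : z = 0 \/ z = 1.
  by case: z => [[|[|?]] ?] //; [left|right]; apply/val_inj.
all: ring.
Qed.

Lemma cross_lt0 (p q : V) : (cross p q < 0) = (0 < cross q p).
Proof. by rewrite -oppr_gt0; congr (0 < _); rewrite /cross; ring. Qed.

(** After the last common gate the two rays leave one triangle through different sides, hence on
    different sides of its apex, which is the tip of the common word. *)
Lemma meet_between O d1 d2 T i r k1 k2 : area T != 0 -> k1 != k2 ->
  front O T i ->
  crosses O d1 T (rcons (i :: r) k1) -> crosses O d2 T (rcons (i :: r) k2) ->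
  exists a b : R, [/\ 0 < a, 0 < b &
    tip T (i :: r) - O = a *: d1 + b *: d2].
Proof.
elim: r T i => [|k r IH] T i T0 k12 f.
  rewrite /= !andbT => /andP[g1 e1] /andP[g2 e2].
  have n1 := gate_next_neq T0 g1 e1.
  have n2 := gate_next_neq T0 g2 e2.
  have W := @front_step _ _ _ _ _ T0 _ (gate_wgate T0 _) (gate_wgate _ _) f.
  have F0 : area (flip i T) != 0 by rewrite area_flip oppr_eq0.
  have := W _ _ n1 g1 F0 e1; have := W _ _ n2 g2 F0 e2.
  move: g1 g2 e1 e2; rewrite !gateE // /front /tip /=.
  set X := flip i T i.
  case: (two_exits T0 n1 n2 k12) => [[-> -> -> ->]|[-> -> -> ->]]
    /andP[r1 l1] /andP[r2 l2] /andP[x1 y1] /andP[x2 y2] f1 f2.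
  - have d12 : 0 < cross d1 d2.
      set p := gR T i - O in r1 r2 f2; set q := X - O in y1 x2 f2.
      (* Plücker relation between four plane vectors. The sign of [cross p q] comes from [front], so
         the order of the exits gives the order of the rays. *)
      have E : cross p q * cross d1 d2 =
        (- cross d1 p) * (- cross d2 q) + (- cross d2 p) * cross d1 q.
        by rewrite /cross; ring.
      rewrite -(pmulr_rgt0 _ f2) E.
      by rewrite addr_gt0 // mulr_gt0 // oppr_gt0.
    exact: cross_between d12 y1 x2.
  - have d21 : 0 < cross d2 d1.
      set p := gR T i - O in r1 r2 f1; set q := X - O in y2 x1 f1.
      have E : cross p q * cross d2 d1 =
        (- cross d2 p) * (- cross d1 q) + (- cross d1 p) * cross d2 q.
        by rewrite /cross; ring.
      rewrite -(pmulr_rgt0 _ f1) E.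
      by rewrite addr_gt0 // mulr_gt0 // oppr_gt0.
    have [a [b [a0 b0 E]]] := cross_between d21 y2 x1.
    by exists b, a; split=> //; rewrite E addrC.
move=> c1 c2; have -> : tip T [:: i, k & r] = tip (flip i T) (k :: r) by [].
move: c1 c2 => /= /andP[g1 c1] /andP[g2 c2].
have g1' : gate O d1 (flip i T) k by case/andP: c1.
have ki := gate_next_neq T0 g1 g1'.
have F0 : area (flip i T) != 0 by rewrite area_flip oppr_eq0.
apply: (IH (flip i T)) => //.
exact: (front_step T0 ki (gate_wgate T0 g1) (gate_wgate F0 g1') f).
Qed.

Lemma diagonal_front T w : area T != 0 ->
  front (T (head 0 w)) T (head 0 w).
Proof. by move=> T0; rewrite /front gate_area normr_gt0. Qed.

(** The vertex at which two diagonals part is visible from their common origin, in a direction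
    between theirs. So the words of the diagonals in a cone are closed under branching points and
    form a tree. *)
Lemma meet_diagonal T i r k1 k2 r1 r2 : area T != 0 -> k1 != k2 ->
  let w1 := (i :: r) ++ k1 :: r1 in let w2 := (i :: r) ++ k2 :: r2 in
  diagonal T w1 -> diagonal T w2 ->
  diagonal T (i :: r) /\ exists a b : R, [/\ 0 < a, 0 < b &
    tip T (i :: r) - T i = a *: (tip T w1 - T i) + b *: (tip T w2 - T i)].
Proof.
move=> T0 k12 w1 w2 /andP[_ c1] /andP[_ c2].
have f : front (T i) T i := diagonal_front [:: i] T0.
rewrite -[head 0 w1]/i in c1; rewrite -[head 0 w2]/i in c2.
set d1 := tip T w1 - T i in c1 *; set d2 := tip T w2 - T i in c2 *.
rewrite /w1 -cat_rcons crosses_cat in c1.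
rewrite /w2 -cat_rcons crosses_cat in c2.
have /andP[c1' _] := c1; have /andP[c2' _] := c2.
have [a [b [a0 b0 E]]] := meet_between T0 k12 f c1' c2'.
split; last by exists a, b.
rewrite /diagonal /= E.
move: c1' c2'; rewrite -!cats1 !crosses_cat => /andP[c1' _] /andP[c2' _].
apply: (crosses_cone T0 (ltW a0) b0 _ c2').
exact: crosses_wcrosses.
Qed.

(** The ray [d1] is to the right of [d2], so along the gates crossed by [d2] it can be stopped only
    by a new right end. The first vertex that stops it lies strictly between the two rays. *)
Lemma first_between O d1 d2 T k r : area T != 0 -> 0 < cross d1 d2 ->
  wgate O d1 T k -> front O T k -> crosses O d2 T (k :: r) ->
  wcrosses O d1 T (k :: r) \/
  exists r1 k' r2, [/\ k :: r = (k :: r1) ++ k' :: r2,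
    0 < cross d1 (tip T (k :: r1) - O), cross d2 (tip T (k :: r1) - O) < 0 &
    wcrosses O d1 T (k :: r1)].
Proof.
move=> + d12; elim: r T k => [|k' r IH] T k T0 w1 f.
  by rewrite /= w1; left.
have F0 : area (flip k T) != 0 by rewrite area_flip oppr_eq0.
move=> /= /and3P[g2 g2' c].
have kk := gate_next_neq T0 g2 g2'.
have f' := front_step T0 kk (gate_wgate T0 g2) (gate_wgate F0 g2') f.
have cc : crosses O d2 (flip k T) (k' :: r) by rewrite /= g2'.
have main : wgate O d1 (flip k T) k' ->
    wcrosses O d1 (flip k T) (k' :: r) \/
  exists r1 (k'0 : 'I_3) (r2 : seq 'I_3),
    [/\ [:: k, k' & r] = k :: r1 ++ k'0 :: r2, 0 < cross d1 (tip T (k :: r1) - O),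
        cross d2 (tip T (k :: r1) - O) < 0
      & wgate O d1 T k && wcrosses O d1 (flip k T) r1].
  move=> w2; have [->|[r1 [k2 [r2 [E x1 x2 c1]]]]] := IH _ _ F0 w2 f' cc.
    by left.
  right; exists (k' :: r1), k2, r2; split => //; first by rewrite E.
  by rewrite w1.
suff: wgate O d1 (flip k T) k' \/
  (0 < cross d1 (flip k T k - O) /\ cross d2 (flip k T k - O) < 0).
  case=> [/main [H|H]|[x1 x2]].
  - by left; rewrite w1.
  - right; have [r1 [k2 [r2 [E x1 x2 c1]]]] := H.
    by exists r1, k2, r2.
  - by right; exists [::], k', r; rewrite /= w1; split.
move: w1 g2 g2' f'; rewrite !gateE // /wgate /front.
set X := flip k T k.
have [[-> ->]|[-> ->]] := gate_next T0 kk => /andP[a1 a2] /andP[b1 b2]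
  /andP[e1 e2] f'.
- left; rewrite a1 /=.
  move: a1 b1 e2 f'; set p := gR T k - O; set q := X - O => a1 b1 e2 f'.
  have E : (- cross d2 p) * cross d1 q =
    cross d1 d2 * cross p q - cross d1 p * cross d2 q.
    by rewrite /cross; ring.
  have n : 0 < - cross d2 p by lra.
  rewrite -(pmulr_rgt0 _ n) E.
  have : 0 < cross d1 d2 * cross p q by rewrite mulr_gt0.
  have : 0 <= - cross d1 p * cross d2 q by apply: mulr_ge0; lra.
  lra.
- by case: (lerP (cross d1 (X - O)) 0) => H; [left; rewrite a2|right].
Qed.

(* The segment from [p] to [q] meets the line through [r] and [l]; the two
   identities locate the intersection point strictly between [r] and [l]. *)
Lemma segment_crosses (p q r l : V) : 0 < cross p q ->
  cross p r <= 0 < cross p l -> cross q r < 0 < cross q l ->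
  0 < cross (r - p) (l - p) -> cross (r - q) (l - q) < 0 ->
  cross (q - p) (r - p) < 0 < cross (q - p) (l - p).
Proof.
move=> pq /andP[pr pl] /andP[qr ql] N F.
set K := cross (r - p) (l - p) - cross (r - q) (l - q).
have K0 : 0 < K by rewrite /K; lra.
have E1 : (cross q l - cross q r) * cross (q - p) (l - p) =
  K * cross q l - cross (r - q) (l - q) * cross p q.
  by rewrite /K /cross !mxE; ring.
have E2 : (cross p l - cross p r) * cross (q - p) (r - p) =
  K * cross p r - cross (r - p) (l - p) * cross p q.
  by rewrite /K /cross !mxE; ring.
have n1 : 0 < cross q l - cross q r by lra.
have n2 : 0 < cross p l - cross p r by lra.
apply/andP; split.
- rewrite -(pmulr_rlt0 _ n2) E2.
  have : 0 < cross (r - p) (l - p) * cross p q by rewrite mulr_gt0.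
  have : 0 <= K * - cross p r by apply: mulr_ge0; lra.
  lra.
- rewrite -(pmulr_rgt0 _ n1) E1.
  have : 0 < K * cross q l by rewrite mulr_gt0.
  have : 0 < - cross (r - q) (l - q) * cross p q by apply: mulr_gt0; lra.
  lra.
Qed.

(** Every gate spans both rays from [O] and has [v1] in front of it and [v2] beyond it, so it cuts
    the segment from [v1] to [v2]. *)
Lemma segment_diagonal O v1 v2 T i r : area T != 0 ->
  0 < cross (v1 - O) (v2 - O) ->
  wcrosses O (v1 - O) T (i :: r) -> crosses O (v2 - O) T (i :: r) ->
  front v1 T i -> tip T (i :: r) = v2 ->
  crosses v1 (v2 - v1) T (i :: r).
Proof.
move=> T0 v12 w1 w2 f1 t.
(* Moving the base point along the line of the ray changes none of the sign conditions. *)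
have shift p X : cross (p - O) (X - O) = cross (p - O) (X - p).
  by rewrite /cross !mxE; ring.
have shiftg T' k : gate O (v2 - O) T' k = gate v2 (v2 - O) T' k.
  by rewrite /gate !shift.
have shiftc T' w : crosses O (v2 - O) T' w = crosses v2 (v2 - O) T' w.
  by elim: w T' => //= k w IH T'; rewrite shiftg IH.
have main T' k : area T' != 0 -> wgate O (v1 - O) T' k ->
    gate O (v2 - O) T' k -> front v1 T' k -> far v2 T' k ->
    gate v1 (v2 - v1) T' k.
  move=> T'0 g1; rewrite !gateE // => g2 f fr.
  have E p X : X - p = (X - O) - (p - O) by rewrite opprB addrA subrK.
  rewrite (E v1 v2) (E v1 (gR T' k)) (E v1 (gL T' k)).
  by apply: segment_crosses => //; rewrite -!E.
elim: r i T T0 w1 w2 f1 t => [|k r IH] i T T0 w1 w2 f1 t.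
  move: w1 w2 => /=; rewrite !andbT => w1 w2.
  apply: main => //; rewrite -t; apply: (far_tip (d := v2 - O)) => //.
  by rewrite t -shiftc /= w2.
have F : far v2 T i.
  rewrite -t; apply: (far_tip (d := v2 - O)) => //.
  by rewrite t -shiftc.
move: w1 w2 => /= /and3P[a1 a2 a3] /and3P[b1 b2 b3].
have ki := gate_next_neq T0 b1 b2.
have F0 : area (flip i T) != 0 by rewrite area_flip oppr_eq0.
rewrite main //=; apply: IH => //=; rewrite ?a2 ?b2 //.
apply: (@front_step _ (v1 - O) T i k) => //.
  by move: a1; rewrite /wgate !shift.
by move: a2; rewrite /wgate !shift.
Qed.

Lemma unfold_map (f : V -> V) T T' w j k :
  (forall (a b : R) u v, f (a *: u + b *: v) = a *: f u + b *: f v) ->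
  (forall j k, T' j - T' k = f (T j - T k)) ->
  unfold T' w j - unfold T' w k = f (unfold T w j - unfold T w k).
Proof.
move=> fL; elim: w T T' => //= i w IH T T' TT'.
apply: IH => {}j {}k.
have fB u v : f (u - v) = f u - f v.
  by have := fL 1 (-1) u v; rewrite !scale1r !scaleN1r.
have E (X : ('I_3 -> V) -> 'I_3 -> V) :
    (forall j', X T' j' - T' i = f (X T j' - T i)) ->
    X T' j - X T' k = f (X T j - X T k).
  move=> H; have -> : X T j - X T k = (X T j - T i) - (X T k - T i).
    by rewrite opprB addrA subrK.
  by rewrite fB -!H opprB addrA subrK.
apply: (E (fun T => flip i T)) => j'; rewrite /flip; case: ifP => // _.
have A S : (2 * h i) *: S (i + 1) + (2 * (1 - h i)) *: S (i + 2) - S i - S i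
  = (2 * h i) *: (S (i + 1) - S i) + (2 * (1 - h i)) *: (S (i + 2) - S i) :> V.
  by apply/rowP => z; rewrite !mxE; ring.
by rewrite !A !TT' fL.
Qed.

Lemma unfold_map_base (f : V -> V) T T' O O' w j :
  (forall (a b : R) u v, f (a *: u + b *: v) = a *: f u + b *: f v) ->
  (forall j, T' j - O' = f (T j - O)) ->
  unfold T' w j - O' = f (unfold T w j - O).
Proof.
move=> fL; elim: w T T' => //= i w IH T T' TT'.
apply: IH => {}j; rewrite /flip; case: ifP => // _.
have fB u v : f (u - v) = f u - f v.
  by have := fL 1 (-1) u v; rewrite !scale1r !scaleN1r.
have A (S : 'I_3 -> V) P :
    (2 * h i) *: S (i + 1) + (2 * (1 - h i)) *: S (i + 2) - S i - P
  = (2 * h i) *: (S (i + 1) - P) + (2 * (1 - h i)) *: (S (i + 2) - P) - (S i - P).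
  by apply/rowP => z; rewrite !mxE; ring.
by rewrite !A !TT' -fL -fB.
Qed.

Lemma diagonal_map (f : V -> V) (e : R) T T' w :
  (forall (a b : R) u v, f (a *: u + b *: v) = a *: f u + b *: f v) ->
  e != 0 -> (forall u v, cross (f u) (f v) = e * cross u v) ->
  (forall j k, T' j - T' k = f (T j - T k)) ->
  diagonal T' w = diagonal T w.
Proof.
move=> fL e0 fe TT'; rewrite /diagonal; congr (_ && _).
set O := T (head 0 w); set O' := T' (head 0 w).
have H j : T' j - O' = f (T j - O) by exact: TT'.
have -> : tip T' w - O' = f (tip T w - O) by apply: unfold_map_base.
exact: (crosses_map _ _ fL e0 fe H).
Qed.

Lemma unfold_notin T w a : a \notin w -> unfold T w a = T a.
Proof.
elim: w T => //= i w IH T; rewrite inE negb_or => /andP[ai aw].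
by rewrite [LHS]IH // flip_neq.
Qed.

(* Two generalized diagonals from the same vertex, the word of one being a
   prefix of the word of the other: either a diagonal with an intermediate word
   leaves between them, or the vector joining their tips is a side or a shorter
   generalized diagonal of some copy of the triangle. *)
Definition gap_alternative T w r : Prop :=
  let O := T (head 0 w) in
  let p := tip T w - O in let q := tip T (w ++ r) - O in
  [\/ exists r1 r2, [/\ r = r1 ++ r2, r1 != [::], r2 != [::],
        diagonal T (w ++ r1) &
        exists a b : R, [/\ 0 < a, 0 < b &
          tip T (w ++ r1) - O = a *: p + b *: q]],
      exists j1 j2, j1 != j2 /\
        q - p = unfold T (w ++ r) j2 - unfold T (w ++ r) j1
    | exists (u : seq 'I_3) i s, [/\ w ++ r = u ++ i :: s, (size s < size r)%N,
        diagonal (unfold T u) (i :: s) &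
        q - p = tip (unfold T u) (i :: s) - unfold T u i]].

Lemma wcrosses_cat O d T w r :
  wcrosses O d T (w ++ r) = wcrosses O d T w && wcrosses O d (unfold T w) r.
Proof. by elim: w T => //= i w IH T; rewrite IH andbA. Qed.

Lemma crosses_front O d T i w k : area T != 0 -> front O T i ->
  crosses O d T (rcons (i :: w) k) -> front O (unfold T (i :: w)) k.
Proof.
elim: w T i => [|j w IH] T i T0 f /= /andP[g1] c;
  have g2 := c; move: g2 => /andP[g2 _];
  have F0 : area (flip i T) != 0 by rewrite area_flip oppr_eq0.
all: have f' := front_step T0 (gate_next_neq T0 g1 g2) (gate_wgate T0 g1)
  (gate_wgate F0 g2) f.
- by [].
- exact: IH.
Qed.

Lemma mem_split_first (A : eqType) (x : A) (s : seq A) : x \in s ->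
  exists s1 s2, s = s1 ++ x :: s2 /\ x \notin s1.
Proof.
elim: s => // y s IH; rewrite inE; have [->|xy] /= := eqVneq x y.
  by exists [::], s.
move=> /IH[s1 [s2 [-> n]]]; exists (y :: s1), s2.
by rewrite inE negb_or xy.
Qed.

(** Let [v1] and [v2] be the two tips. If no vertex separates the rays towards them, both rays pass
    all gates of [k :: r]. The vertex [v1] stays in the current triangle until its letter [l] is
    flipped. If this never happens, [v1] and [v2] are vertices of the last triangle. Otherwise the
    segment from [v1] to [v2] is a diagonal of the copy reached just before the first such flip. *)
Lemma gap_positive T w k r : area T != 0 ->
  diagonal T w -> diagonal T (w ++ k :: r) ->
  0 < cross (tip T w - T (head 0 w)) (tip T (w ++ k :: r) - T (head 0 w)) ->
  gap_alternative T w (k :: r).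
Proof.
move=> T0; case/lastP: w => [//|w l].
rewrite /gap_alternative; set O := T (head 0 _).
have diagE r1 : diagonal T (rcons w l ++ r1) =
    crosses O (tip T (rcons w l ++ r1) - O) T (rcons w l ++ r1).
  by rewrite /O /diagonal; case: (w).
have := diagE [::]; rewrite cats0 => ->; rewrite diagE.
set v1 := tip T (rcons w l); set v2 := tip T (rcons w l ++ k :: r).
move=> c1 c2 v12.
set T1 := unfold T (rcons w l).
have nz w' : area (unfold T w') != 0.
  by rewrite area_unfold mulf_neq0 // signr_eq0.
have T1E : T1 = flip l (unfold T w) by rewrite /T1 -cats1 unfold_cat.
have v1E : v1 = T1 l by rewrite /v1 /tip last_rcons.
have g1 : gate O (v1 - O) (unfold T w) l.
  by move: c1; rewrite -cats1 crosses_cat /= andbT => /andP[].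
move: (c2); rewrite crosses_cat => /andP[c2w c2r].
have g2 : gate O (v2 - O) (unfold T w) l.
  by move: c2w; rewrite -cats1 crosses_cat /= andbT => /andP[].
have g2' : gate O (v2 - O) T1 k by case/andP: c2r.
have kl : k != l.
  apply: (@gate_next_neq O (v2 - O) (unfold T w)) => //; by rewrite -T1E.
(* As [k != l], the vertex [v1] is an end of this gate; it is the right end because [v2] is on the
   left of the ray towards [v1]. *)
have w1 : wgate O (v1 - O) T1 k.
  move: g1 g2'; rewrite !gateE // ?/T1 // -/T1 /wgate T1E.
  have [[-> ->]|[-> ->]] := gate_next (nz w) kl;
    rewrite -T1E -v1E => /andP[a1 a2] /andP[b1 b2].
  - by move: v12 b2; rewrite /cross; lra.
  - rewrite a2 andbT; suff -> : cross (v1 - O) (v1 - O) = 0 by [].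
    by rewrite /cross; ring.
have fT1 : front O T1 k.
  have := c2; rewrite -cat_rcons crosses_cat => /andP[+ _].
  rewrite /T1; have : front O T (head 0 (rcons w l)) by apply: diagonal_front.
  case: (rcons w l) (headI w l) => // i w' _ /= f c.
  by apply: crosses_front c.
have tipT1 k' r' : tip T (rcons w l ++ k' :: r') = tip T1 (k' :: r').
  exact: tip_cat.
have T1l : T1 l = v1 by [].
have [wc|[r1 [k' [r2 [E x1 x2 wc]]]]] :=
  first_between (nz _) v12 w1 fT1 c2r; last first.
- constructor 1; exists (k :: r1), (k' :: r2).
  have [a [b [a0 b0 Eab]]] := cross_between v12 x1 x2.
  split => //; last by exists a, b; rewrite tipT1.
  rewrite diagE tipT1 Eab crosses_cat.
  apply/andP; split.
    exact: (crosses_cone T0 (ltW a0) b0 (crosses_wcrosses T0 c1) c2w).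
  apply: (crosses_cone _ (ltW a0) b0 wc); first exact: nz.
  by move: c2r; rewrite E crosses_cat => /andP[].
- have [lr|lr] := boolP (l \in k :: r); last first.
    constructor 2; exists l, (last k r); split.
      by apply: contraNneq lr => ->; apply: mem_last.
    rewrite opprB addrA subrK; congr (_ - _).
      by rewrite /v2 /tip last_cat.
    by rewrite unfold_cat unfold_notin.
  have [s1 [s2 [Es l1]]] := mem_split_first lr.
  constructor 3; exists (rcons w l ++ s1), l, s2.
  have El : unfold T (rcons w l ++ s1) l = v1 by rewrite unfold_cat unfold_notin.
  have Et : tip (unfold T (rcons w l ++ s1)) (l :: s2) = v2.
    by rewrite -tip_cat -catA -Es.
  split.
  - by rewrite Es catA.
  - by rewrite Es size_cat /= addnS ltnS leq_addl.
  - rewrite /diagonal /= El Et unfold_cat.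
    have := Et; rewrite unfold_cat => Et'.
    have F : front v1 (unfold T1 s1) l.
      rewrite -El unfold_cat.
      by apply: (@diagonal_front (unfold T1 s1) [:: l]); rewrite -unfold_cat.
    apply: (@segment_diagonal O v1 v2) => //; first by rewrite -unfold_cat.
    + by move: wc; rewrite Es wcrosses_cat => /andP[].
    + by move: c2r; rewrite Es crosses_cat => /andP[].
  - by rewrite Et El opprB addrA subrK.
Qed.

Lemma gate_cross_neq0 O d T k j : gate O d T k -> j != k ->
  cross d (T j - O) != 0.
Proof.
move=> /andP[a b]; have [->|->|->] := I3_cases k j; first by rewrite eqxx.
- by move=> _; apply: contraTneq a => ->; rewrite mulr0 ltxx.
- by move=> _; apply: contraTneq b => ->; rewrite mulr0 ltxx.
Qed.

(** The tip of [w] is an end of the gate [k], which the longer diagonal crosses strictly between its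
    ends. *)
Lemma diagonal_prefix_cross T w k r : area T != 0 ->
  diagonal T w -> diagonal T (w ++ k :: r) ->
  cross (tip T w - T (head 0 w)) (tip T (w ++ k :: r) - T (head 0 w)) != 0.
Proof.
move=> T0; case/lastP: w => [//|w l] _.
rewrite /diagonal.
have -> : head 0 (rcons w l ++ k :: r) = head 0 (rcons w l) by case: w.
set O := T _ => /andP[_]; set d := _ - O => c.
have E : cross (tip T (rcons w l) - O) d = - cross d (unfold T (rcons w l) l - O).
  by rewrite {1}/tip last_rcons /cross; ring.
rewrite E oppr_eq0.
move: c; rewrite crosses_cat => /andP[c1 /=/andP[g2 _]].
move: c1; rewrite -cats1 crosses_cat /= andbT => /andP[_ g1].
rewrite cats1; apply: (gate_cross_neq0 g2); rewrite eq_sym.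
have g2' : gate O d (flip l (unfold T w)) k.
  by move: g2; rewrite -cats1 unfold_cat.
by apply: (gate_next_neq _ g1 g2'); rewrite area_unfold mulf_neq0 // signr_eq0.
Qed.

(** The exchange of the two coordinates reverses orientation, which gives [gap] from [gap_positive]
    for the other order of the tips. *)
Definition mirror u : V := \row_z u 0 (1 - z).

Lemma mirrorK : involutive mirror.
Proof. by move=> u; apply/rowP => z; rewrite !mxE subKr. Qed.

Lemma mirror_lin (a b : R) u v :
  mirror (a *: u + b *: v) = a *: mirror u + b *: mirror v.
Proof. by apply/rowP => z; rewrite !mxE. Qed.

Lemma mirrorB u v : mirror (u - v) = mirror u - mirror v.
Proof. by apply/rowP => z; rewrite !mxE. Qed.

Lemma cross_mirror u v : cross (mirror u) (mirror v) = -1 * cross u v.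
Proof. by rewrite /cross !mxE subr0 subrr; ring. Qed.

Lemma gap T w k r : area T != 0 ->
  diagonal T w -> diagonal T (w ++ k :: r) -> gap_alternative T w (k :: r).
Proof.
move=> T0 d1 d2; have := diagonal_prefix_cross T0 d1 d2.
case: ltgtP => // c _; last exact: gap_positive.
pose T' j := mirror (T j).
have TT j j' : T' j - T' j' = mirror (T j - T j') by rewrite mirrorB.
have TT0 j : T' j - 0 = mirror (T j - 0) by rewrite !subr0.
have uE w' j : unfold T' w' j = mirror (unfold T w' j).
  by have := unfold_map_base w' j mirror_lin TT0; rewrite !subr0.
have m0 : (-1 : R) != 0 by rewrite oppr_eq0 oner_eq0.
have dE S S' w' : (forall j j', S' j - S' j' = mirror (S j - S j')) ->
    diagonal S' w' = diagonal S w'.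
  by move=> H; apply: (diagonal_map _ mirror_lin m0 cross_mirror H).
have tE w' : tip T' w' = mirror (tip T w') by exact: uE.
have T'0 : area T' != 0.
  by rewrite /area !TT cross_mirror mulf_neq0.
have back u v : mirror u = mirror v -> u = v by exact: (can_inj mirrorK).
have : gap_alternative T' w (k :: r).
  apply: gap_positive => //; rewrite ?(dE T) //.
  by rewrite !tE -!mirrorB cross_mirror mulN1r oppr_gt0.
rewrite /gap_alternative !tE /T' -!mirrorB.
case=> [[r1 [r2 [E n1 n2 dd [a [b [a0 b0]]]]]]|[j1 [j2 [n]]]|[u [i [s [E sz dd]]]]].
- rewrite tE -mirrorB -mirror_lin => /back e.
  constructor 1; exists r1, r2; split => //; first by rewrite -(dE T T').
  by exists a, b.
- rewrite !uE -!mirrorB => /back e.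
  by constructor 2; exists j1, j2.
- rewrite -tip_cat tE uE -!mirrorB => /back e.
  constructor 3; exists u, i, s; split => //; last by rewrite -tip_cat.
  by rewrite -(dE (unfold T u) (unfold T' u)) // => j j'; rewrite !uE mirrorB.
Qed.

(** * Diagonals in a narrow cone of directions *)

Section Cell.

Variable P : 'I_3 -> V.
Hypothesis P0 : area P != 0.

(* Coordinates in the basis formed by the two sides at [P a]. The line through
   [P a] directed by [v] meets the opposite side at
   [(1 - slope a v) *: P (a + 1) + slope a v *: P (a + 2)]; the slope is 0 for
   [v] parallel to that side. *)
Definition coord1 a v : R := cross v (P (a + 2) - P a) / area P.
Definition coord2 a v : R := cross (P (a + 1) - P a) v / area P.
Definition level a v : R := coord1 a v + coord2 a v.
Definition slope a v : R := coord2 a v / level a v.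

Definition direction w : V := tip P w - P (head 0 w).

Lemma coord1D a (x y : R) u v :
  coord1 a (x *: u + y *: v) = x * coord1 a u + y * coord1 a v.
Proof. by rewrite /coord1 /cross !mxE; ring. Qed.

Lemma coord2D a (x y : R) u v :
  coord2 a (x *: u + y *: v) = x * coord2 a u + y * coord2 a v.
Proof. by rewrite /coord2 /cross !mxE; ring. Qed.

Lemma coord1B a u v : coord1 a (u - v) = coord1 a u - coord1 a v.
Proof. by rewrite /coord1 /cross !mxE; ring. Qed.

Lemma coord2B a u v : coord2 a (u - v) = coord2 a u - coord2 a v.
Proof. by rewrite /coord2 /cross !mxE; ring. Qed.

Lemma levelB a u v : level a (u - v) = level a u - level a v.
Proof. by rewrite /level coord1B coord2B; ring. Qed.

Lemma levelD a (x y : R) u v :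
  level a (x *: u + y *: v) = x * level a u + y * level a v.
Proof. by rewrite /level coord1D coord2D; ring. Qed.

Lemma direction_coord w : diagonal P w ->
  0 < coord1 (head 0 w) (direction w) /\ 0 < coord2 (head 0 w) (direction w).
Proof.
case: w => // a w; rewrite /diagonal /= => /andP[/andP[g1 g2] _].
move: g1 g2; rewrite /direction /coord1 /coord2 /=.
set d := tip _ _ - _.
have A2 : 0 < area P ^+ 2 by rewrite lt_neqAle sqr_ge0 eq_sym sqrf_eq0 P0.
have E (x : R) : x / area P = area P * x / area P ^+ 2 by field.
have A2V : 0 < (area P ^+ 2)^-1 by rewrite invr_gt0.
rewrite !E !(pmulr_lgt0 _ A2V) // => H H2; split; first exact: H2.
by rewrite -oppr_lt0; move: H; rewrite /cross; lra.
Qed.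

Lemma level_far a v : (level a v - 1) * area P =
  - cross (P (a + 1) - P a - v) (P (a + 2) - P a - v).
Proof.
have -> : (level a v - 1) * area P =
  cross v (P (a + 2) - P a) + cross (P (a + 1) - P a) v - area P.
  by rewrite /level /coord1 /coord2; field.
by rewrite (areaE P a) /cross !mxE; ring.
Qed.

(** The line [level = 1] carries the side opposite to the base vertex, and by [far_tip] the tip lies
    beyond it. *)
Lemma direction_level w : diagonal P w -> 1 < level (head 0 w) (direction w).
Proof.
case: w => // a w H; rewrite -subr_gt0.
have A2 : 0 < area P ^+ 2 by rewrite lt_neqAle sqr_ge0 eq_sym sqrf_eq0 P0.
rewrite -(pmulr_lgt0 _ A2) expr2 mulrA level_far /=.
have F : far (tip P (a :: w)) P a.
  apply: (far_tip (d := direction (a :: w)) P0).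
  have shift T k X : cross (direction (a :: w)) (X - P a) =
     cross (direction (a :: w)) (X - tip P (a :: w)).
    by rewrite /direction /cross !mxE; ring.
  have : forall T s, crosses (P a) (direction (a :: w)) T s =
      crosses (tip P (a :: w)) (direction (a :: w)) T s.
    move=> T s; elim: s T => //= k s IH T.
    by rewrite IH /gate !(shift T k).
  by move=> <-; case/andP: H.
have E X : X - P a - direction (a :: w) = X - tip P (a :: w).
  by rewrite /direction /= opprB addrA subrK.
rewrite !E; move: F; rewrite /far /gR /gL.
case: (ltgtP (area P) 0) P0 => // A _; last first.
  by move=> F; rewrite pmulr_lgt0 // oppr_gt0.
move=> F; rewrite nmulr_lgt0 // oppr_lt0.
by rewrite -cross_lt0.
Qed.

Definition dslope w : R := slope (head 0 w) (direction w).

Lemma dslope_itv w : diagonal P w -> 0 < dslope w < 1.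
Proof.
move=> H; have [c1 c2] := direction_coord H; rewrite /dslope /slope.
have L : 0 < level (head 0 w) (direction w) by apply: addr_gt0.
by rewrite divr_gt0 // ltr_pdivrMr // mul1r /level ltrDr.
Qed.

Lemma slope_between (p q : R) a u v x y : 0 < x -> 0 < y ->
  0 < level a u -> 0 < level a v ->
  p <= slope a u <= q -> p <= slope a v <= q ->
  p <= slope a (x *: u + y *: v) <= q.
Proof.
move=> x0 y0 lu lv.
have l0 : 0 < x * level a u + y * level a v by rewrite addr_gt0 ?mulr_gt0.
rewrite /slope levelD coord2D !(ler_pdivlMr _ _ lu, ler_pdivlMr _ _ lv,
  ler_pdivlMr _ _ l0, ler_pdivrMr _ _ lu, ler_pdivrMr _ _ lv,
  ler_pdivrMr _ _ l0).
move=> /andP[h1 h2] /andP[h3 h4].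
have := ler_wpM2l (ltW x0) h1; have := ler_wpM2l (ltW x0) h2.
have := ler_wpM2l (ltW y0) h3; have := ler_wpM2l (ltW y0) h4.
by move=> *; apply/andP; split; lra.
Qed.

(* The vectors provided by [gap] for words of length at most [2 * m] whose
   lengths differ by at most [m]. *)
Definition gap_vector m v : Prop :=
  (exists w j1 j2, [/\ (size w <= m.*2)%N, j1 != j2 &
     v = unfold P w j2 - unfold P w j1]) \/
  (exists w i r, [/\ (size w + (size r).+1 <= m.*2)%N, (size r < m)%N,
     diagonal (unfold P w) (i :: r) &
     v = tip (unfold P w) (i :: r) - unfold P w i]).

Variables (m : nat) (a : 'I_3) (c M p q : R).
Hypothesis c_gt0 : 0 < c.
Hypothesis M_gt0 : 0 < M.
Hypothesis level_le : forall w, diagonal P w -> (size w <= m.*2)%N ->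
  level (head 0 w) (direction w) <= M.
Hypothesis gap_ge : forall v, gap_vector m v ->
  c <= `|coord1 a v| + `|coord2 a v|.
Hypothesis short : 4 * M * (q - p) <= c.
Hypothesis away : forall v, gap_vector m v ->
  (2 * M / c + 2) * (q - p) <= `|slope a v - p|.

Definition in_cell w : Prop :=
  [/\ diagonal P w, head 0 w = a, (size w <= m.*2)%N & p <= dslope w <= q].

(** With slopes [x], [y] and levels [s], [t], the difference has slope [x + t * (y - x) / (t - s)].
    Since it has size at least [c], [short] leaves [c / 2 <= |t - s|]. Its slope is then within
    [(2 * M / c + 1) * (q - p)] of [p], against [away]. *)
Lemma gap_vector_slope u v : 0 < level a u <= M -> 0 < level a v <= M ->
  0 < slope a u < 1 -> p <= slope a u <= q -> p <= slope a v <= q ->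
  slope a u != slope a v -> gap_vector m (v - u) -> False.
Proof.
move=> /andP[u0 uM] /andP[v0 vM] /andP[x0 x1] /andP[pu uq] /andP[pv vq] uv G.
have := gap_ge G; have := away G.
have pq : 0 < q - p by case: ltgtP uv => //; lra.
rewrite coord1B coord2B /slope levelB coord2B -!/(slope _ _).
have E2 z : 0 < level a z -> coord2 a z = slope a z * level a z.
  by move=> z0; rewrite /slope divfK // gt_eqF.
have E1 z : 0 < level a z -> coord1 a z = (1 - slope a z) * level a z.
  by move=> z0; rewrite mulrBl -E2 // mul1r /level addrK.
rewrite !E1 // !E2 //.
set x := slope a u in x0 x1 pu uq uv *; set y := slope a v in pv vq uv *.
set s := level a u in u0 uM *; set t := level a v in v0 vM *.
move=> aw ge.
have yx : `|y - x| <= q - p by rewrite ler_norml; lra.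
have tyx : `|t * (y - x)| <= M * (q - p).
  by rewrite normrM ler_pM // gtr0_norm.
have ts : c / 2 <= `|t - s|.
  have N1 : `|(1 - y) * t - (1 - x) * s| <= (1 - x) * `|t - s| + M * (q - p).
    have -> : (1 - y) * t - (1 - x) * s = (1 - x) * (t - s) - t * (y - x) by ring.
    apply: (le_trans (ler_normB _ _)); apply: lerD => //.
    by rewrite normrM gtr0_norm ?subr_gt0.
  have N2 : `|y * t - x * s| <= x * `|t - s| + M * (q - p).
    have -> : y * t - x * s = x * (t - s) + t * (y - x) by ring.
    apply: (le_trans (ler_normD _ _)); apply: lerD => //.
    by rewrite normrM gtr0_norm.
  move: (le_trans ge (lerD N1 N2)) short; rewrite -(mulrA 4).
  by move: `|t - s| (M * (q - p)) => A B; lra.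
have ts0 : 0 < `|t - s| by apply: lt_le_trans ts; rewrite divr_gt0.
have ts0' : t - s != 0 by rewrite -normr_gt0.
have B : `|(y * t - x * s) / (t - s) - p| <= 2 * M / c * (q - p) + (q - p).
  have -> : (y * t - x * s) / (t - s) - p = t * (y - x) / (t - s) + (x - p).
    by field.
  apply: (le_trans (ler_normD _ _)); apply: lerD; last by rewrite ger0_norm; lra.
  rewrite normrM normfV ler_pdivrMr //; apply: (le_trans tyx).
  have -> : 2 * M / c * (q - p) * `|t - s| = M * (q - p) * (`|t - s| / (c / 2)).
    by field; rewrite gt_eqF.
  rewrite ler_peMr ?mulr_ge0 ?(ltW pq) ?(ltW M_gt0) //.
  by rewrite ler_pdivlMr ?mul1r // divr_gt0.
lra.
Qed.

Lemma slope_neq u v : 0 < level a u -> 0 < level a v -> cross u v != 0 ->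
  slope a u != slope a v.
Proof.
move=> u0 v0; apply: contraNneq.
have E2 z : 0 < level a z -> coord2 a z = slope a z * level a z.
  by move=> z0; rewrite /slope divfK // gt_eqF.
have E1 z : 0 < level a z -> coord1 a z = (1 - slope a z) * level a z.
  by move=> z0; rewrite mulrBl -E2 // mul1r /level addrK.
have : cross u v = (coord1 a u * coord2 a v - coord2 a u * coord1 a v) * area P.
  have -> : (coord1 a u * coord2 a v - coord2 a u * coord1 a v) * area P =
    (cross u (P (a + 2) - P a) * cross (P (a + 1) - P a) v
     - cross (P (a + 1) - P a) u * cross v (P (a + 2) - P a)) / area P.
    by rewrite /coord1 /coord2; field.
  apply: (mulIf P0); rewrite divfK // (areaE P a) /cross !mxE; ring.
move=> -> e; apply/eqP; rewrite !E1 // !E2 // e; ring.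
Qed.

(** If the extension were short, [gap] would give a vector excluded by [gap_vector_slope] or an
    intermediate diagonal. The latter is in the cell by convexity and extends [w] by fewer letters,
    so induction applies. *)
Lemma in_cell_gap w k r : in_cell w -> in_cell (w ++ k :: r) ->
  (m <= size r)%N.
Proof.
elim/ltn_ind: {r}(size r) {-2}r (erefl (size r)) k => n IH r rn k cw cr.
have [H|//] := ltnP (size r) m; rewrite rn in H *.
case: (cw) (cr) => [dw hw sw iw] [dr hr sr ir].
have hE r' : head 0 (w ++ r') = head 0 w by case: (w) dw.
have dE r' : direction (w ++ r') = tip P (w ++ r') - P a.
  by rewrite /direction hE hw.
have dE0 : direction w = tip P w - P a by rewrite /direction hw.
have lw : 1 < level a (direction w) by rewrite -hw; apply: direction_level.
have lr : 1 < level a (direction (w ++ k :: r)).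
  by rewrite -hr; apply: direction_level.
have contra : gap_vector m (direction (w ++ k :: r) - direction w) -> False.
  apply: gap_vector_slope.
  - by rewrite (lt_trans ltr01 lw) /= -hw level_le.
  - by rewrite (lt_trans ltr01 lr) /= -hr level_le.
  - by rewrite -hw; apply: dslope_itv.
  - by rewrite -hw.
  - by rewrite -hr.
  - apply: slope_neq; try exact: (lt_trans ltr01).
    by rewrite dE dE0 -hw; apply: diagonal_prefix_cross.
have := gap P0 dw dr; rewrite /gap_alternative hw -dE -dE0.
case=> [[r1 [r2 [E n1 n2 d1 [x [y [x0 y0]]]]]]|[j1 [j2 [n1 E]]]|
        [u [i [s [E sz ds Es]]]]].
- rewrite -dE => Exy; case: r1 n1 d1 E Exy => // k1 r1 _ d1 [_ E] Exy.
  have sr1 : (size r1 < n)%N.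
    by rewrite -rn E size_cat -[X in (X < _)%N]addn0 ltn_add2l lt0n size_eq0.
  have /(IH _ sr1 r1 erefl k1 cw) : in_cell (w ++ k1 :: r1).
    split=> //; first by rewrite hE.
    + apply: leq_trans sr; rewrite !size_cat leq_add2l /= E size_cat.
      by rewrite ltnS leq_addr.
    + rewrite /dslope hE hw Exy; apply: slope_between => //;
        try exact: (lt_trans ltr01).
        by rewrite -hw.
      by rewrite -hr.
  by move=> H1; rewrite leqNgt in H1; rewrite (ltn_trans sr1 H) in H1.
- by exfalso; apply: contra; left; exists (w ++ k :: r), j1, j2.
- exfalso; apply: contra; right; exists u, i, s; split => //.
    by have := sr; rewrite E size_cat.
  by apply: leq_ltn_trans H; rewrite -rn.
Qed.

Lemma in_cell_meet (u : seq 'I_3) x y s t : x != y -> in_cell (u ++ x :: s) ->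
  in_cell (u ++ y :: t) -> in_cell u.
Proof.
move=> xy [d1 h1 s1 i1] [d2 h2 s2 i2].
case: u d1 h1 s1 i1 d2 h2 s2 i2 => [|i u] d1 h1 s1 i1 d2 h2 s2 i2.
  by move: xy; rewrite /= in h1 h2; rewrite h1 h2 eqxx.
rewrite /= in h1 h2.
have [d [al [be [a0 b0 E]]]] := meet_diagonal P0 xy d1 d2.
split=> //; first by apply: leq_trans s1; rewrite size_cat leq_addr.
rewrite /dslope /direction /= E; apply: slope_between => //.
- by rewrite (lt_trans ltr01) //; apply: (direction_level d1).
- by rewrite (lt_trans ltr01) //; apply: (direction_level d2).
Qed.

(* By [in_cell_gap] the words in the cell form a tree of depth at most 2, with
   at most one branch for each letter following the root. *)
Lemma in_cell_card (L : seq (seq 'I_3)) : uniq L ->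
  (forall w, w \in L -> in_cell w) -> (size L <= 4)%N.
Proof.
case: L => // w0 L0; set L := w0 :: L0 => uL HL.
have : exists n, `[< exists2 w, in_cell w & size w = n >].
  by exists (size w0); apply/asboolP; exists w0 => //; apply: HL; rewrite mem_head.
move=> /ex_minnP[n /asboolP[r0 cr0 nE] nmin].
(* The root [r0] is a shortest word of the cell. Were it not a prefix of [w], their meet would be a
   shorter word of the cell. *)
have pre w : in_cell w -> exists r, w = r0 ++ r.
  move=> cw.
  have min w' : in_cell w' -> (size r0 <= size w')%N.
    by move=> cw'; rewrite nE; apply: nmin; apply/asboolP; exists w'.
  case: (seq_meet r0 w) => [//|[[|k r] E]|[u [x [y [s [t [xy E1 E2]]]]]]].
  - by exists [::]; rewrite E !cats0.
  - by have := min w cw; rewrite E size_cat /= addnS ltnNge leq_addr.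
  - rewrite E1 in cr0 min; rewrite E2 in cw.
    have := min u (in_cell_meet xy cr0 cw).
    by rewrite size_cat /= addnS ltnNge leq_addr.
have key w w' : in_cell w -> in_cell w' -> w != r0 -> w' != r0 ->
    nth 0 w (size r0) = nth 0 w' (size r0) -> w = w'.
  move=> cw cw'; have [r E] := pre w cw; have [r' E'] := pre w' cw'.
  rewrite {}E {}E' in cw cw' *.
  case: r cw => [|k r] cw; first by rewrite cats0 eqxx.
  case: r' cw' => [|k' r'] cw'; first by rewrite cats0 eqxx.
  move=> _ _; rewrite !nth_cat ltnn subnn /= => kk; rewrite -{}kk in cw' *.
  have H1 := in_cell_gap cr0 cw; have H2 := in_cell_gap cr0 cw'.
  (* Each extension adds at least [m + 1] letters, so two successive ones exceed the length
     [2 * m]. *)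
  have two (s : seq 'I_3) l t : in_cell (r0 ++ k :: s) -> in_cell (r0 ++ k :: s ++ l :: t) ->
      False.
    move=> cv cvt; have := in_cell_gap cr0 cv.
    rewrite -cat_cons catA in cvt; have := in_cell_gap cv cvt.
    case: cvt => _ _; rewrite !size_cat /=; clear; lia.
  case: (seq_meet r r') => [[[|l t] E]|[[|l t] E]|[u [x [y [s [t [xy E1 E2]]]]]]].
  - by rewrite E cats0.
  - by exfalso; apply: (two r l t); rewrite -?E.
  - by rewrite E cats0.
  - by exfalso; apply: (two r' l t); rewrite -?E.
  - exfalso; apply: (two u x s); last by rewrite -E1.
    rewrite E1 in cw; rewrite E2 in cw'.
    by apply: (in_cell_meet xy); rewrite -catA /=; [exact: cw|exact: cw'].
pose f w := nth 0 w (size r0).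
have : uniq (map f [seq w <- L | w != r0]).
  rewrite map_inj_in_uniq ?filter_uniq // => w w'.
  rewrite !mem_filter => /andP[n1 /HL c1] /andP[n2 /HL c2].
  exact: key.
move/card_uniqP; rewrite size_map => E.
have : (size [seq w <- L | w != r0] <= 3)%N.
  by rewrite -E -[X in (_ <= X)%N](card_ord 3) max_card.
rewrite size_filter; have := count_predC (pred1 r0) L.
have : (count (pred1 r0) L <= 1)%N by rewrite (count_uniq_mem _ uL) leq_b1.
have -> : count (fun w => w != r0) L = count (predC (pred1 r0)) L by [].
by move=> H1 <- H2; apply: (@leq_add _ _ 1 3).
Qed.

End Cell.

End Unfolding.

(** * Linear parts of the unfolding maps *)

Section Isometries.
Variable R : realType.
Local Notation V := 'rV[R]_2.
Implicit Types (u v : V) (phi psi : R) (b c : bool).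

(* Rotation by [phi], after complex conjugation if [b]. *)
Definition isometry phi b v : V :=
  \row_z (if z == 0 then cos phi * v 0 0 - sin phi * ((-1) ^+ b * v 0 1)
          else sin phi * v 0 0 + cos phi * ((-1) ^+ b * v 0 1)).

Lemma rowP2 u v : u 0 0 = v 0 0 -> u 0 1 = v 0 1 -> u = v.
Proof.
move=> h0 h1; apply/rowP; case=> [[|[|//]] ?].
- by rewrite (_ : Ordinal _ = 0) //; apply/val_inj.
- by rewrite (_ : Ordinal _ = 1) //; apply/val_inj.
Qed.

Lemma isometry_lin phi b (x y : R) u v :
  isometry phi b (x *: u + y *: v) =
  x *: isometry phi b u + y *: isometry phi b v.
Proof. by apply: rowP2; rewrite !mxE /=; ring. Qed.

Lemma isometryB phi b u v :
  isometry phi b (u - v) = isometry phi b u - isometry phi b v.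
Proof. by apply: rowP2; rewrite !mxE /=; ring. Qed.

Lemma isometry_comp phi b psi c v :
  isometry phi b (isometry psi c v) =
  isometry (phi + (-1) ^+ b * psi) (b (+) c) v.
Proof.
case: b; apply: rowP2; rewrite !mxE /= ?expr0 ?expr1 ?mul1r ?mulN1r
  ?cosD ?sinD ?cosN ?sinN; case: c => /=; rewrite ?expr0 ?expr1; ring.
Qed.

Lemma isometry0 v : isometry 0 false v = v.
Proof. by apply: rowP2; rewrite !mxE /= cos0 sin0; ring. Qed.

Lemma cross_isometry phi b u v :
  cross (isometry phi b u) (isometry phi b v) = (-1) ^+ b * cross u v.
Proof.
rewrite /cross !mxE /=.
have -> : (-1) ^+ b * (u 0 0 * v 0 1 - u 0 1 * v 0 0) =
  (cos phi ^+ 2 + sin phi ^+ 2) * ((-1) ^+ b * (u 0 0 * v 0 1 - u 0 1 * v 0 0)).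
  by rewrite cos2Dsin2 mul1r.
ring.
Qed.

Lemma angle_exists (x y : R) : x ^+ 2 + y ^+ 2 = 1 ->
  exists phi, cos phi = x /\ sin phi = y.
Proof.
move=> xy.
have x2 : x ^+ 2 <= 1 by rewrite -xy lerDl sqr_ge0.
have x1 : -1 <= x <= 1.
  by rewrite -ler_norml -(@ler_pXn2r _ 2) // ?nnegrE // expr1n -normrX ger0_norm ?sqr_ge0.
have y2 : y ^+ 2 = 1 - x ^+ 2 by lra.
have [y0|y0] := lerP 0 y.
- exists (acos x); rewrite acosK // sin_acos //; split=> //.
  by rewrite -y2 sqrtr_sqr ger0_norm.
- exists (- acos x); rewrite cosN acosK // sinN sin_acos //; split=> //.
  by rewrite -y2 sqrtr_sqr ltr0_norm // opprK.
Qed.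

Definition norm1 v : R := `|v 0 0| + `|v 0 1|.

Lemma norm1_isometry phi b v : norm1 (isometry phi b v) <= 2 * norm1 v.
Proof.
rewrite /norm1 !mxE /=.
have cs (t s : R) : `|t| <= 1 -> `|s| <= 1 ->
    `|t * v 0 0 + s * ((-1) ^+ b * v 0 1)| <= `|v 0 0| + `|v 0 1|.
  move=> t1 s1; apply: (le_trans (ler_normD _ _)).
  rewrite !normrM normr_sign mul1r; apply: lerD; exact: ler_piMl.
have c1 : `|cos phi| <= 1 by rewrite ler_norml cos_geN1 cos_le1.
have s1 : `|sin phi| <= 1 by rewrite ler_norml sin_geN1 sin_le1.
have := cs _ _ c1 (_ : `|- sin phi| <= 1); rewrite normrN mulNr => /(_ s1).
have := cs _ _ s1 c1; lra.
Qed.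

End Isometries.

Section Bounds.
Variable R : realType.
Local Notation V := 'rV[R]_2.
Implicit Types (u v : V) (phi psi : R) (b : bool).
Variable P : 'I_3 -> V.
Hypothesis P0 : area P != 0.
Local Notation coord1 := (coord1 P).
Local Notation coord2 := (coord2 P).
Local Notation level := (level P).

Definition coord_norm a v : R := `|coord1 a v| + `|coord2 a v|.

Lemma coordE a v :
  v = coord1 a v *: (P (a + 1) - P a) + coord2 a v *: (P (a + 2) - P a).
Proof.
apply: rowP2; apply: (mulIf P0);
  rewrite !/(coord1 _ _) !/(coord2 _ _) {1}(areaE P a) /cross !mxE.
all: have Q : area P = cross (P (a + 1) - P a) (P (a + 2) - P a) by exact: areaE.
all: have := P0; rewrite Q /cross !mxE => H; field; exact: H.
Qed.

Lemma coord_normD a u v : coord_norm a (u + v) <= coord_norm a u + coord_norm a v.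
Proof.
have := coord1D P a 1 1 u v; have := coord2D P a 1 1 u v.
rewrite /coord_norm !scale1r !mul1r => -> ->.
have := ler_normD (coord1 a u) (coord1 a v).
have := ler_normD (coord2 a u) (coord2 a v); lra.
Qed.

(** The coordinate norms at the three vertices are equivalent to [norm1], which an isometry at most
    doubles. The constant is a natural number because it enters the number of cells. *)
Lemma isometry_bound : exists K : nat, (0 < K)%N /\
  forall a a' phi b v,
    coord_norm a (isometry phi b v) <= K%:R * coord_norm a' v.
Proof.
pose N := \sum_a (norm1 (P (a + 1) - P a) + norm1 (P (a + 2) - P a)).
have n0 v : 0 <= norm1 v by rewrite addr_ge0.
have N0 : 0 <= N by apply: sumr_ge0 => a _; rewrite addr_ge0.
have Na a : norm1 (P (a + 1) - P a) + norm1 (P (a + 2) - P a) <= N.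
  rewrite /N (bigD1 a) //= lerDl; apply: sumr_ge0 => a' _; rewrite addr_ge0 //.
have up a v : norm1 v <= N * coord_norm a v.
  rewrite {1}(coordE a v) /norm1 !mxE /coord_norm.
  have := Na a; rewrite /norm1 !mxE.
  set x := coord1 a v; set y := coord2 a v.
  set e0 := P (a + 1) 0 0 - P a 0 0; set e1 := P (a + 1) 0 1 - P a 0 1.
  set f0 := P (a + 2) 0 0 - P a 0 0; set f1 := P (a + 2) 0 1 - P a 0 1.
  move=> NN; clearbody x y e0 e1 f0 f1.
  have h1 := ler_normD (x * e0) (y * f0); have h2 := ler_normD (x * e1) (y * f1).
  rewrite !(normrM x) !(normrM y) in h1 h2.
  apply: (@le_trans _ _ ((`|e0| + `|e1| + (`|f0| + `|f1|)) * (`|x| + `|y|))).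
    have : 0 <= (`|e0| + `|e1|) * `|y| by apply: mulr_ge0 => //; rewrite addr_ge0.
    have : 0 <= (`|f0| + `|f1|) * `|x| by apply: mulr_ge0 => //; rewrite addr_ge0.
    lra.
  by apply: ler_wpM2r => //; rewrite addr_ge0.
have cr u v : `|cross u v| <= norm1 u * norm1 v.
  have h1 := ler_normB (u 0 0 * v 0 1) (u 0 1 * v 0 0).
  rewrite !normrM in h1; apply: (le_trans h1); rewrite /norm1.
  have : 0 <= `|u 0 0| * `|v 0 0| by apply: mulr_ge0.
  have : 0 <= `|u 0 1| * `|v 0 1| by apply: mulr_ge0.
  lra.
have dn a v : coord_norm a v <= N / `|area P| * norm1 v.
  rewrite /coord_norm !/(coord1 _ _) !/(coord2 _ _) !normrM !normfV -mulrDl.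
  rewrite mulrAC ler_wpM2r ?invr_ge0 //.
  have h1 := cr v (P (a + 2) - P a); have h2 := cr (P (a + 1) - P a) v.
  have := ler_wpM2r (n0 v) (Na a); lra.
pose K0 := N / `|area P| * (2 * N).
have K00 : 0 <= K0 by rewrite !mulr_ge0 ?invr_ge0.
exists (Num.truncn K0).+1; split => // a a' phi b v.
apply: (le_trans (dn a _)); apply: (@le_trans _ _ (K0 * coord_norm a' v)).
  rewrite /K0 -[leRHS]mulrA ler_wpM2l ?mulr_ge0 ?invr_ge0 //.
  apply: (le_trans (norm1_isometry _ _ _)).
  by rewrite -[leRHS]mulrA ler_wpM2l.
apply: ler_wpM2r; first by rewrite addr_ge0.
exact: ltW (truncnS_gt _).
Qed.

End Bounds.

Section Reflections.
Variable R : realType.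
Local Notation V := 'rV[R]_2.
Implicit Types (u v : V) (phi psi : R) (b : bool).

Lemma dotE u v : dot u v = u 0 0 * v 0 0 + u 0 1 * v 0 1.
Proof.
rewrite /dot big_ord_recl big_ord1.
by rewrite (_ : lift ord0 ord0 = 1) //; apply/val_inj.
Qed.

Lemma dot_gt0 v : v != 0 -> 0 < dot v v.
Proof.
move=> v0; rewrite lt_neqAle dotE -!expr2 addr_ge0 ?sqr_ge0 // andbT eq_sym.
apply: contraNneq v0 => /eqP; rewrite paddr_eq0 ?sqr_ge0 // !sqrf_eq0.
by move=> /andP[/eqP a /eqP c]; apply/eqP/rowP2; rewrite ?a ?c mxE.
Qed.

Variable P : 'I_3 -> V.
Hypothesis P0 : area P != 0.

(* The foot of the altitude from [P i] is
   [foot i *: P (i + 1) + (1 - foot i) *: P (i + 2)]. *)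
Definition foot i : R :=
  let s := P (i + 2) - P (i + 1) in dot (P (i + 2) - P i) s / dot s s.

Lemma side_neq0 i : P (i + 2) - P (i + 1) != 0.
Proof.
apply: contraNneq P0 => H; have E : P (i + 2) = P (i + 1).
  by apply/eqP; rewrite -subr_eq0 H.
by apply/eqP; rewrite (areaE P i) E /cross; ring.
Qed.

Lemma flip_isometry i : exists psi, forall j k,
  flip foot i P j - flip foot i P k = isometry psi true (P j - P k).
Proof.
have s0 := dot_gt0 (side_neq0 i).
set s := P (i + 2) - P (i + 1) in s0.
have s0' : dot s s != 0 by rewrite gt_eqF.
(* Cosine and sine of twice the angle of [s]: the reflection in a line of direction [s] is
   conjugation followed by this rotation. *)
pose x := (s 0 0 ^+ 2 - s 0 1 ^+ 2) / dot s s.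
pose y := 2 * s 0 0 * s 0 1 / dot s s.
have [|psi [cx sy]] := @angle_exists R x y.
  by rewrite /x /y; move: s0'; rewrite dotE => s0'; field.
exists psi.
suff H j : flip foot i P j - P (i + 1) = isometry psi true (P j - P (i + 1)).
  move=> j k; have -> : P j - P k = (P j - P (i + 1)) - (P k - P (i + 1)).
    by rewrite opprB addrA subrK.
  by rewrite isometryB -!H opprB addrA subrK.
have [->|->|->] := I3_cases i j.
- have E : flip foot i P i - P (i + 1) =
    (2 * (dot (P i - P (i + 1)) s / dot s s)) *: s - (P i - P (i + 1)).
    rewrite flip_same /foot -/s.
    have -> : dot (P (i + 2) - P i) s = dot s s - dot (P i - P (i + 1)) s.
      by rewrite !dotE /s !mxE; ring.
    by apply: rowP2; rewrite /s !mxE; field.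
  rewrite {}E; set u := P i - P (i + 1).
  rewrite /x /y in cx sy; clear x y; clearbody s u.
  apply: rowP2; rewrite !mxE /= cx sy; move: s0'; rewrite !dotE => s0';
    by field.
- by rewrite flip1 subrr; apply: rowP2; rewrite !mxE /=; ring.
- rewrite flip2 -/s; rewrite /x /y in cx sy; clear x y; clearbody s.
  apply: rowP2; rewrite !mxE /= cx sy; move: s0';
    rewrite !dotE => s0'; by field.
Qed.

(* The rotation part is a signed sum of the angles of the three reflections,
   hence takes only polynomially many values. *)
Lemma unfold_isometry : exists psi : 'I_3 -> R, forall w N, (size w <= N)%N ->
  exists e e' : {ffun 'I_3 -> 'I_N.+1}, forall j k,
    unfold foot P w j - unfold foot P w k =
    isometry (\sum_i ((e i)%:R - (e' i)%:R) * psi i) (odd (size w)) (P j - P k).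
Proof.
have [psi psiP] := boolp.choice flip_isometry.
exists psi => w N wN.
suff [e [e' [eN e'N H]]] : exists e e' : 'I_3 -> nat,
    [/\ forall i, (e i <= size w)%N, forall i, (e' i <= size w)%N &
    forall j k, unfold foot P w j - unfold foot P w k =
    isometry (\sum_i ((e i)%:R - (e' i)%:R) * psi i) (odd (size w)) (P j - P k)].
  exists [ffun i => inord (e i)], [ffun i => inord (e' i)] => j k.
  rewrite H; congr isometry; apply: eq_bigr => i _.
  by rewrite !ffunE !inordK // ltnS (leq_trans _ wN).
elim/last_ind: w {wN N} => [|w i [e [e' [eN e'N H]]]].
  exists (fun=> 0%N), (fun=> 0%N); split => // j k.
  by rewrite big1 ?isometry0 // => i _; rewrite subrr mul0r.
have L b phi := isometry_lin phi b.
(* Unfolding commutes with affine maps, so a further flip composes the linear part with the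
   reflection of [P] itself, applied first. The parity of [w] gives the sign of the new angle. *)
have E j k : unfold foot P (rcons w i) j - unfold foot P (rcons w i) k =
    isometry (\sum_i ((e i)%:R - (e' i)%:R) * psi i + (-1) ^+ odd (size w) * psi i)
      (~~ odd (size w)) (P j - P k).
  rewrite -cats1 !unfold_cat.
  have := @unfold_map _ foot _ P (unfold foot P w) [:: i] j k (L _ _) H.
  by move=> ->; rewrite [X in isometry _ _ X]psiP isometry_comp addbT.
pose b := odd (size w).
exists (fun l => e l + ((l == i) && ~~ b))%N, (fun l => e' l + ((l == i) && b))%N.
split=> [l|l|j k]; rewrite ?size_rcons.
- by apply: leq_trans (leq_add (eN l) (leq_b1 _)) _; rewrite addn1.
- by apply: leq_trans (leq_add (e'N l) (leq_b1 _)) _; rewrite addn1.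
rewrite E /=; congr isometry.
rewrite (bigD1 i) //= [RHS](bigD1 i) //= eqxx /= -addrA [_ + (-1) ^+ _ * _]addrC addrA.
congr (_ + _); last first.
  by apply: eq_bigr => l /negbTE li; rewrite li !addn0.
by rewrite !natrD -/b; case: b => /=; ring.
Qed.

End Reflections.

(** * Integrality and separation of slopes *)

Section VertexBounds.
Variable R : realType.
Local Notation V := 'rV[R]_2.
Implicit Types (u v : V).
Variable P : 'I_3 -> V.
Hypothesis P0 : area P != 0.
Local Notation h := (foot P).
Local Notation unfold := (unfold h).
Local Notation tip := (tip h).
Local Notation diagonal := (diagonal h).
Local Notation gap_vector := (gap_vector h P).
Local Notation coord1 := (coord1 P).
Local Notation coord2 := (coord2 P).
Local Notation coord_norm := (coord_norm P).
Local Notation level := (level P).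
Local Notation slope := (slope P).
Local Notation direction := (direction h P).

Variable K : nat.
Hypothesis K_gt0 : (0 < K)%N.
Hypothesis KP : forall a a' phi b v,
  coord_norm a (isometry phi b v) <= K%:R * coord_norm a' v.

Lemma isometry_inv phi b v : exists psi, isometry psi b (isometry phi b v) = v.
Proof.
exists (- ((-1) ^+ b * phi)); rewrite isometry_comp addbb.
by rewrite addNr isometry0.
Qed.

Lemma coord_norm_side i j : i != j -> coord_norm i (P j - P i) = 1.
Proof.
have [->|->|->] := I3_cases i j; rewrite ?eqxx // => _.
all: rewrite !/(coord_norm _ _) !/(coord1 _ _) !/(coord2 _ _) -?areaE ?divff // normr1.
- rewrite [cross (P _ - _) (P _ - _)](_ : _ = 0) ?mul0r ?normr0 ?addr0 //.
  by rewrite /cross; ring.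
- rewrite [cross (P _ - _) (P _ - _)](_ : _ = 0) ?mul0r ?normr0 ?add0r //.
  by rewrite /cross; ring.
Qed.

Lemma level_le_norm a v : `|level a v| <= coord_norm a v.
Proof. exact: ler_normD. Qed.

Lemma diagonal_unfold (u : seq 'I_3) i r phi b :
  (forall j k, unfold P u j - unfold P u k = isometry phi b (P j - P k)) ->
  diagonal (unfold P u) (i :: r) = diagonal P (i :: r) /\
  tip (unfold P u) (i :: r) - unfold P u i = isometry phi b (direction (i :: r)).
Proof.
move=> H; split.
  apply: (@diagonal_map _ _ (isometry phi b) ((-1) ^+ b)) => //.
  - exact: isometry_lin.
  - by rewrite signr_eq0.
  - exact: cross_isometry.
apply: unfold_map_base; first exact: isometry_lin.
by move=> j; apply: H.
Qed.

Definition unfolding_angles (psi : 'I_3 -> R) : Prop :=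
  forall w N, (size w <= N)%N ->
  exists e e' : {ffun 'I_3 -> 'I_N.+1}, forall j k,
    unfold P w j - unfold P w k =
    isometry (\sum_i ((e i)%:R - (e' i)%:R) * psi i) (odd (size w)) (P j - P k).

(** Source of the bound on [Y]: a gap vector is the image, under one of polynomially many
    isometries, of a side of [P] or of a diagonal of [P] of length at most [m]. *)
Lemma gap_vector_isometry psi m v : unfolding_angles psi -> gap_vector m v ->
  exists (e e' : {ffun 'I_3 -> 'I_(m.*2).+1}) b v',
  v = isometry (\sum_i ((e i)%:R - (e' i)%:R) * psi i) b v' /\
  ((exists j1 j2, j1 != j2 /\ v' = P j2 - P j1) \/
   (exists w, [/\ (size w <= m)%N, diagonal P w & v' = direction w])).
Proof.
move=> psiP; case=> [[w [j1 [j2 [sw jj ->]]]]|[u [i [r [su sr d ->]]]]].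
- have [e [e' H]] := psiP w _ sw.
  by rewrite H; do 4 eexists; split; first by []; left; exists j1, j2.
- have su' : (size u <= m.*2)%N by apply: leq_trans su; rewrite leq_addr.
  have [e [e' H]] := psiP u _ su'.
  have [E ->] := diagonal_unfold i r H.
  exists e, e', (odd (size u)), (direction (i :: r)); split=> //; right.
  by exists (i :: r); rewrite -E.
Qed.

(** Undoing the isometry costs a factor [K] and leaves a side, of norm 1, or a diagonal, of level
    greater than 1. *)
Lemma gap_vector_ge m a v : gap_vector m v -> K%:R^-1 <= coord_norm a v.
Proof.
have K0 : 0 < K%:R :> R by rewrite ltr0n.
rewrite -[_^-1]mul1r ler_pdivrMr // mulrC.
have [psi psiP] := unfold_isometry P0.
move=> /(gap_vector_isometry psiP)[e [e' [b [v' [-> H]]]]].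
set phi := \sum_i _.
have [psi' E] := isometry_inv phi b v'.
have le a' : coord_norm a' v' <= K%:R * coord_norm a (isometry phi b v').
  by rewrite -{1}E.
case: H => [[j1 [j2 [jj ->]]]|[w [_ dw E']]] in le *.
  by apply: le_trans (le j1); rewrite coord_norm_side.
apply: le_trans (le (head 0 w)); rewrite E'.
have := direction_level P0 dw; have := level_le_norm (head 0 w) (direction w).
by have := ler_norm (level (head 0 w) (direction w)); lra.
Qed.

(** A flipped vertex is one side away from a vertex that did not move, so each flip adds at most
    [K]. *)
Lemma vertex_norm a w j :
  coord_norm a (unfold P w j - P a) <= K%:R * (size w)%:R + 1.
Proof.
elim/last_ind: w j => [|w i IH] j.
  rewrite mulr0 add0r /=; have [<-|aj] := eqVneq a j.
    rewrite subrr !/(coord_norm _ _) !/(coord1 _ _) !/(coord2 _ _).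
    by rewrite /cross !mxE !(mul0r, mulr0) subrr !mul0r normr0 addr0.
  by rewrite coord_norm_side.
rewrite size_rcons -natr1 mulrDr mulr1.
have E : unfold P (rcons w i) = flip h i (unfold P w) by rewrite -cats1 unfold_cat.
have K0 : 0 <= K%:R :> R by rewrite ler0n.
have [->|ij] := eqVneq j i; last first.
  by rewrite E flip_neq //; have := IH j; lra.
rewrite -(subrK (unfold P (rcons w i) (i + 1)) (unfold P (rcons w i) i)) -addrA.
apply: (le_trans (coord_normD _ _ _ _)).
have [psi psiP] := unfold_isometry P0.
have [e [e' ->]] := psiP (rcons w i) _ (leqnn _).
have := KP a (i + 1) (\sum_i0 ((e i0)%:R - (e' i0)%:R) * psi i0)
   (odd (size (rcons w i))) (P i - P (i + 1)).
rewrite coord_norm_side ?I3_neq //.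
rewrite E flip1; have := IH (i + 1); lra.
Qed.

Lemma direction_norm w : diagonal P w ->
  coord_norm (head 0 w) (direction w) <= K%:R * (size w)%:R + 1.
Proof. by move=> _; apply: vertex_norm. Qed.

Lemma gap_vector_vertices m v : gap_vector m v -> exists w w' j j',
  [/\ (size w <= m.*2)%N, (size w' <= m.*2)%N &
      v = unfold P w j - unfold P w' j'].
Proof.
case=> [[w [j1 [j2 [sw jj ->]]]]|[u [i [r [su sr d ->]]]]].
  by exists w, w, j2, j1.
exists (u ++ i :: r), u, (last i r), i; split.
- by rewrite size_cat.
- by apply: leq_trans su; rewrite leq_addr.
- by rewrite /(tip _ _) -unfold_cat.
Qed.

Lemma gap_vector_le m a v : gap_vector m v ->
  coord_norm a v <= 2 * (K%:R * (m.*2)%:R + 1).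
Proof.
move=> /gap_vector_vertices[w [w' [j [j' [sw sw' ->]]]]].
have -> : unfold P w j - unfold P w' j' =
    (unfold P w j - P a) + - (unfold P w' j' - P a).
  by rewrite opprB addrA subrK.
apply: (le_trans (coord_normD _ _ _ _)).
have -> : coord_norm a (- (unfold P w' j' - P a)) =
    coord_norm a (unfold P w' j' - P a).
  have := coord1D P a (-1) 0 (unfold P w' j' - P a) 0.
  have := coord2D P a (-1) 0 (unfold P w' j' - P a) 0.
  rewrite scale0r addr0 scaleN1r !mulN1r !mul0r !addr0 !/(coord_norm _ _).
  by move=> -> ->; rewrite !normrN.
have := vertex_norm a w j; have := vertex_norm a w' j'.
have : K%:R * (size w)%:R <= K%:R * (m.*2)%:R :> R.
  by rewrite ler_wpM2l ?ler0n // ler_nat.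
have : K%:R * (size w')%:R <= K%:R * (m.*2)%:R :> R.
  by rewrite ler_wpM2l ?ler0n // ler_nat.
lra.
Qed.

Variable D : nat.
Hypothesis D_gt0 : (0 < D)%N.
Hypothesis D_int : forall i, D%:R * (2 * h i) \is a Num.int.

(** The coefficients of a flip are integers divided by [D], so each letter costs one factor [D]. *)
Lemma vertex_int a w j n : (size w <= n)%N ->
  (D%:R ^+ n * coord1 a (unfold P w j - P a) \is a Num.int) /\
  (D%:R ^+ n * coord2 a (unfold P w j - P a) \is a Num.int).
Proof.
suff [H1 H2] : (D%:R ^+ size w * coord1 a (unfold P w j - P a) \is a Num.int) /\
    (D%:R ^+ size w * coord2 a (unfold P w j - P a) \is a Num.int).
  move=> /subnK <-; rewrite exprD -!mulrA.
  by split; apply: rpredM => //; rewrite rpredX // rpred_nat.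
elim/last_ind: w j => [|w i IH] j.
  rewrite /= !mul1r !/(coord1 _ _) !/(coord2 _ _).
  have [->|->|->] := I3_cases a j.
  - by rewrite subrr /cross !mxE !(mul0r, mulr0) subrr !mul0r rpred0.
  - rewrite -areaE divff // rpred1; split => //.
    by rewrite (_ : cross _ _ = 0) ?mul0r ?rpred0 // /cross; ring.
  - rewrite -areaE divff // rpred1; split => //.
    by rewrite (_ : cross _ _ = 0) ?mul0r ?rpred0 // /cross; ring.
rewrite size_rcons.
have E : unfold P (rcons w i) = flip h i (unfold P w) by rewrite -cats1 unfold_cat.
have Di : D%:R \is a @Num.int R by rewrite rpred_nat.
have [->|ij] := eqVneq j i; last first.
  by rewrite E flip_neq // exprS -!mulrA; have [? ?] := IH j; split; apply: rpredM.
rewrite E flip_same.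
set X := unfold P w (i + 1); set Y := unfold P w (i + 2); set Z := unfold P w i.
have -> : (2 * h i) *: X + (2 * (1 - h i)) *: Y - Z - P a =
  1 *: ((2 * h i) *: (X - P a) + (2 * (1 - h i)) *: (Y - P a)) + -1 *: (Z - P a).
  by apply: rowP2; rewrite !mxE; ring.
rewrite !coord1D !coord2D exprS.
have [x1 x2] := IH (i + 1); have [y1 y2] := IH (i + 2); have [z1 z2] := IH i.
have EE (x y z : R) : D%:R ^+ size w * x \is a Num.int ->
    D%:R ^+ size w * y \is a Num.int -> D%:R ^+ size w * z \is a Num.int ->
    D%:R * D%:R ^+ size w *
    (1 * (2 * h i * x + 2 * (1 - h i) * y) + -1 * z) \is a Num.int.
  move=> hx hy hz.
  have -> : D%:R * D%:R ^+ size w *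
    (1 * (2 * h i * x + 2 * (1 - h i) * y) + -1 * z) =
    D%:R * (2 * h i) * (D%:R ^+ size w * x)
    + (D%:R * 2 - D%:R * (2 * h i)) * (D%:R ^+ size w * y)
    - D%:R * (D%:R ^+ size w * z) by ring.
  apply: rpredB; last exact: rpredM.
  apply: rpredD; first exact: rpredM.
  by apply: rpredM => //; apply: rpredB => //; apply: rpredM => //; apply: rpred_nat.
by split; apply: EE.
Qed.

(** For slopes [y / l] and [y' / l'], the number [y * l' - y' * l] is a nonzero integer divided by
    [D ^ (4 * m)], while [l <= M] and [|l'| <= 2 * M]. *)
Lemma slope_separation m w v : diagonal P w -> (size w <= m.*2)%N ->
  gap_vector m v -> dslope h P w != slope (head 0 w) v ->
  (2 * (K%:R * (m.*2)%:R + 1) ^+ 2 * D%:R ^+ (m.*2 + m.*2))^-1 <=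
    `|dslope h P w - slope (head 0 w) v|.
Proof.
move=> dw sw G; rewrite /dslope; set a := head 0 w.
set M := K%:R * (m.*2)%:R + 1.
have M1 : 1 <= M by rewrite lerDr mulr_ge0 ?ler0n.
have D1 : 1 <= D%:R ^+ m.*2 :> R by rewrite exprn_ege1 // ler1n.
have L1 : 1 < level a (direction w) by exact: direction_level.
have LM : level a (direction w) <= M.
  apply: le_trans (le_trans (ler_norm _) (level_le_norm _ _)) _.
  apply: le_trans (direction_norm dw) _.
  by rewrite lerD2r ler_wpM2l ?ler0n // ler_nat.
have [w1 w2] : D%:R ^+ m.*2 * coord1 a (direction w) \is a Num.int /\
    D%:R ^+ m.*2 * coord2 a (direction w) \is a Num.int.
  exact: vertex_int.
have [v1 v2] : D%:R ^+ m.*2 * coord1 a v \is a Num.int /\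
    D%:R ^+ m.*2 * coord2 a v \is a Num.int.
  have [u [u' [j [j' [su su' ->]]]]] := gap_vector_vertices G.
  have [a1 a2] := vertex_int a j su; have [b1 b2] := vertex_int a j' su'.
  have -> : unfold P u j - unfold P u' j' =
    (unfold P u j - P a) - (unfold P u' j' - P a) by rewrite opprB addrA subrK.
  by rewrite coord1B coord2B !mulrBr; split; apply: rpredB.
have LV : `|level a v| <= 2 * M.
  exact: le_trans (level_le_norm _ _) (gap_vector_le a G).
rewrite exprD; set DD := D%:R ^+ m.*2 in D1 w1 w2 v1 v2 *.
rewrite !/(slope _ _).
set l := level a _ in L1 LM *; set l' := level a v in LV *.
set y := coord2 a _ in w2 *; set y' := coord2 a v in v2 *.
have lE : DD * l \is a Num.int by rewrite /l !/(level _ _) mulrDr rpredD.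
have l'E : DD * l' \is a Num.int by rewrite /l' !/(level _ _) mulrDr rpredD.
have DD0 : 0 < DD by lra.
have DDn : DD != 0 by rewrite gt_eqF.
have M0 : 0 < M by lra.
have l0 : l != 0 by rewrite gt_eqF //; lra.
have pos : 0 < 2 * M ^+ 2 * (DD * DD).
  by apply: mulr_gt0; apply: mulr_gt0 => //; exact: exprn_gt0.
(* For level 0 the slope of [v] is 0 by the convention on division, and [y / l] alone is to be
   bounded below. *)
have [l'0|l'0] := eqVneq l' 0.
  rewrite l'0 invr0 mulr0 subr0 => yl.
  have y0 : y != 0 by apply: contraNneq yl => ->; rewrite mul0r.
  have := norm_intr_ge1 w2; rewrite mulf_neq0 // => /(_ isT).
  rewrite normrM (gtr0_norm DD0) => H.
  rewrite normrM normfV (gtr0_norm (_ : 0 < l)); last by lra.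
  rewrite ler_pdivlMr; last by lra.
  rewrite mulrC ler_pdivrMr //.
  have -> : `|y| * (2 * M ^+ 2 * (DD * DD)) = (DD * `|y|) * (2 * M ^+ 2 * DD) by ring.
  have : 1 <= M * DD by rewrite mulr_ege1.
  move=> MD; apply: (le_trans LM).
  have : M * 1 <= 1 * (M * (M * DD)) by rewrite mul1r ler_wpM2l // ltW.
  have : 1 * (M * (M * DD)) <= DD * `|y| * (M * (M * DD)).
    by rewrite ler_wpM2r // !mulr_ge0 ?(ltW M0) ?(ltW DD0).
  have : 0 <= DD * `|y| * (M * (M * DD)) by rewrite !mulr_ge0 ?(ltW M0) ?(ltW DD0) ?normr_ge0.
  rewrite !expr2; lra.
have E : y / l - y' / l' = (y * l' - y' * l) / (l * l') by field; rewrite l0 l'0.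
move=> ne; have ne' : y * l' - y' * l != 0.
  apply: contraNneq ne => H; by rewrite -subr_eq0 E H mul0r.
have I : (DD * y) * (DD * l') - (DD * y') * (DD * l) \is a Num.int.
  by apply: rpredB; apply: rpredM.
have I' : (DD * y) * (DD * l') - (DD * y') * (DD * l) =
  (DD * DD) * (y * l' - y' * l) by ring.
have := norm_intr_ge1 I; rewrite I' !mulf_neq0 // => /(_ isT).
rewrite normrM [`|DD * DD|]gtr0_norm ?mulr_gt0 // => H.
rewrite E normrM normfV ler_pdivlMr ?normr_gt0 ?mulf_neq0 //.
rewrite mulrC ler_pdivrMr //.
rewrite normrM (gtr0_norm (_ : 0 < l)); last by lra.
apply: (@le_trans _ _ (M * (2 * M))); first by rewrite ler_pM //; lra.
set N := `|y * l' - y' * l| in H *.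
have -> : N * (2 * M ^+ 2 * (DD * DD)) = (DD * DD * N) * (M * (2 * M)) by ring.
by rewrite ler_peMl // !mulr_ge0 //; lra.
Qed.

End VertexBounds.

(** * Counting words *)

Lemma size_le_fibers (A : eqType) (X : finType) (f : A -> X) (L : seq A) b :
  (forall x, (size [seq w <- L | f w == x] <= b)%N) -> (size L <= b * #|X|)%N.
Proof.
move=> H; have -> : size L = (\sum_x size [seq w <- L | f w == x])%N.
  elim: L {H} => [|w L IH]; first by rewrite big1.
  rewrite /= IH (bigD1 (f w)) //= [RHS](bigD1 (f w)) //= eqxx /= addSn.
  congr (_ + _).+1; apply: eq_bigr => x /negbTE; by rewrite eq_sym => ->.
rewrite mulnC -sum_nat_const; exact: leq_sum.
Qed.

Section Cells.
Variable R : realFieldType.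

Lemma bernoulli (x : R) n : 0 <= x -> 1 + n%:R * x <= (1 + x) ^+ n.
Proof.
move=> x0; elim: n => [|n IH]; first by rewrite mul0r addr0.
rewrite exprS; apply: (@le_trans _ _ ((1 + x) * (1 + n%:R * x))).
  rewrite -natr1; have : 0 <= n%:R * x * x by rewrite !mulr_ge0 ?ler0n.
  lra.
by rewrite ler_wpM2l // addr_ge0.
Qed.

(* Each point is sent to a nearest element of [Y], the side on which it lies,
   and its distance on a logarithmic scale. *)
Lemma count_cells (A : eqType) (L : seq A) (x : A -> R) (Y : seq R)
    (E l b : nat) :
  (0 < E)%N -> uniq L -> 0 \in Y -> (forall w, w \in L -> 0 < x w < 1) ->
  (forall w y, w \in L -> y \in Y -> x w != y -> (2 ^+ l)^-1 <= `|x w - y|) ->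
  (forall p q, p <= q -> q - p <= E%:R^-1 ->
    (forall y, y \in Y -> (E%:R - 1) * (q - p) <= `|y - p|) ->
    forall L', uniq L' -> {subset L' <= L} ->
    (forall w, w \in L' -> p <= x w <= q) -> (size L' <= b)%N) ->
  (size L <= b * (size Y * 2 * (E * l + 2)))%N.
Proof.
move=> E0 uL Y0 x01 sep cell.
set eta : R := E%:R^-1; set d : R := (2 ^+ l)^-1.
have E0' : 0 < E%:R :> R by rewrite ltr0n.
have eta0 : 0 < eta by rewrite invr_gt0.
have d0 : 0 < d by rewrite invr_gt0 exprn_gt0.
have near w : exists i : 'I_(size Y), forall y, y \in Y ->
    `|x w - Y`_i| <= `|x w - y|.
  have i0P : (index 0%R Y < size Y)%N by rewrite index_mem.
  case: (arg_minP (fun i : 'I_(size Y) => `|x w - Y`_i|) (i0 := Ordinal i0P)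
    (P := xpredT) isT) => i _ H.
  exists i => y yY; have iP : (index y Y < size Y)%N by rewrite index_mem.
  by have := H (Ordinal iP) isT; rewrite /= nth_index.
have [f fP] := boolp.choice near.
pose r w := `|x w - Y`_(f w)|.
(* As [(1 + 1 / E) ^ E >= 2], the shells of ratio [1 + eta] with exponents up to [E * l] reach from
   [2 ^ (- l)] to 1. One more index stands for distance zero. *)
have big : 2 ^+ l <= (1 + eta) ^+ (E * l).
  rewrite exprM lerXn2r ?nnegrE ?exprn_ge0 ?addr_ge0 ?(ltW eta0) //.
  have := bernoulli E (ltW eta0).
  by rewrite /eta divff ?gt_eqF // -natr1 => H; exact: H.
have shell w : exists k : 'I_(E * l + 2), w \in L ->
    (r w = 0 /\ k = 0%N :> nat) \/
    (exists k', k = k'.+1 :> nat /\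
      d * (1 + eta) ^+ k' <= r w < d * (1 + eta) ^+ k'.+1).
  have z : (0 < E * l + 2)%N by rewrite addn2.
  have [wL|] := boolP (w \in L); last by exists (Ordinal z).
  have fY : Y`_(f w) \in Y by apply: mem_nth.
  have [r0|r0] := eqVneq (r w) 0; first by exists (Ordinal z); left.
  have rd : d <= r w.
    by apply: sep => //; rewrite -subr_eq0 -normr_eq0.
  have r1 : r w < 1.
    apply: le_lt_trans (fP w 0 Y0) _; rewrite subr0.
    by have /andP[? ?] := x01 w wL; rewrite gtr0_norm.
  have ex : exists k, r w < d * (1 + eta) ^+ k.+1.
    exists (E * l)%N; apply: lt_le_trans r1 _.
    rewrite -(@ler_pM2l _ (2 ^+ l)) ?exprn_gt0 // mulr1 mulrA /d divff ?mul1r;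
      last by rewrite expf_neq0.
    by rewrite exprS; apply: le_trans big _; rewrite ler_peMl ?exprn_ge0 //; lra.
  case: (ex_minnP ex) => k rk kmin.
  have kl : (k <= E * l)%N.
    apply: kmin; apply: lt_le_trans r1 _.
    rewrite -(@ler_pM2l _ (2 ^+ l)) ?exprn_gt0 // mulr1 mulrA /d divff ?mul1r;
      last by rewrite expf_neq0.
    by rewrite exprS; apply: le_trans big _; rewrite ler_peMl ?exprn_ge0 //; lra.
  have kP : (k.+1 < E * l + 2)%N by rewrite addn2 !ltnS.
  exists (Ordinal kP) => _; right; exists k; split=> //; rewrite rk andbT.
  case: k kmin {kl kP rk} => [|k] kmin; first by rewrite mulr1.
  by rewrite leNgt; apply/negP => /kmin; rewrite ltnn.
have [g gP] := boolp.choice shell.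
pose F w := (f w, Y`_(f w) <= x w, g w).
have -> : (size Y * 2 * (E * l + 2))%N =
    #|{: 'I_(size Y) * bool * 'I_(E * l + 2)}|.
  by rewrite !card_prod !card_ord card_bool.
apply: (size_le_fibers (f := F)) => -[[i s] k].
set L' := [seq _ <- _ | _].
have uL' : uniq L' by exact: filter_uniq.
have sL' : {subset L' <= L} by move=> w; rewrite mem_filter => /andP[].
have FL' w : w \in L' -> [/\ w \in L, f w = i, (Y`_i <= x w) = s & g w = k].
  rewrite mem_filter /F => /andP[/eqP[fi si gk] wL].
  by split=> //; rewrite -fi.
case EL : L' => [//|w0 L'']; rewrite -EL.
have w0L : w0 \in L' by rewrite EL mem_head.
have [w0L0 f0 s0 g0] := FL' _ w0L.
have rE w : w \in L' -> x w = if s then Y`_i + r w else Y`_i - r w.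
  move=> /FL'[_ fi si _]; rewrite /r fi -si; case: leP => H.
    by rewrite ger0_norm ?subr_ge0 // addrC subrK.
  by rewrite ltr0_norm ?subr_lt0 //; ring.
(* The nearest element of [Y] is at distance at least [lo >= E * (q - p)] from [x w0]. Passing from
   [x w0] to [p] loses at most [q - p], whence the factor [E - 1]. *)
have main (lo hi : R) : 0 <= lo -> lo <= hi -> hi - lo <= eta * lo -> lo <= 1 ->
    (forall w, w \in L' -> lo <= r w <= hi) -> (size L' <= b)%N.
  move=> lo0 lohi hl lo1 H.
  pose p := if s then Y`_i + lo else Y`_i - hi.
  pose q := if s then Y`_i + hi else Y`_i - lo.
  have qp : q - p = hi - lo by rewrite /q /p; case: (s); ring.
  have HL w : w \in L' -> p <= x w <= q.
    move=> wL; rewrite (rE _ wL) /p /q; have /andP[h1 h2] := H _ wL.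
    by case: (s); apply/andP; split; lra.
  apply: (cell p q _ _ _ L') => //.
  - by rewrite -subr_ge0 qp subr_ge0.
  - rewrite qp (le_trans hl) // -[leRHS]mulr1 ler_wpM2l // ltW //.
  - move=> y yY; have /andP[h1 h2] := HL _ w0L; have /andP[h3 h4] := H _ w0L.
    have : r w0 <= `|x w0 - y| by apply: fP.
    have : `|x w0 - y| <= `|x w0 - p| + `|y - p|.
      have -> : x w0 - y = (x w0 - p) - (y - p) by ring.
      exact: ler_normB.
    rewrite (ger0_norm (_ : 0 <= x w0 - p)) ?subr_ge0 // mulrBl mul1r.
    have : E%:R * (q - p) <= lo.
      rewrite -(@ler_pM2l _ eta) // mulrA mulVf ?gt_eqF // mul1r qp //.
    lra.
have [[r0 k0]|[k' [kE /andP[h1 h2]]]] := gP w0 w0L0.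
- apply: (main 0 0) => //; first by rewrite mulr0 subrr.
  move=> w /FL'[wL fi si gk]; have [[-> _]|[k' [kk _]]] := gP w wL.
    by rewrite lexx.
  by move: kk; rewrite gk -g0 k0.
- apply: (main (d * (1 + eta) ^+ k') (d * (1 + eta) ^+ k'.+1)).
  + by rewrite mulr_ge0 ?exprn_ge0 ?addr_ge0 ?ltW.
  + by rewrite ler_wpM2l ?(ltW d0) // exprS ler_peMl ?exprn_ge0 //; lra.
  + by rewrite exprS le_eqVlt; apply/orP; left; apply/eqP; ring.
  + apply: (le_trans h1); apply: le_trans (fP w0 0 Y0) _; rewrite subr0.
    by have /andP[? /ltW ?] := x01 _ w0L0; rewrite gtr0_norm.
  + move=> w /FL'[wL fi si gk]; have [[_ kk]|[k'' [kk /andP[h3 /ltW h4]]]] := gP w wL.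
      by move: kk; rewrite gk -g0 kE.
    have -> : k' = k'' by move: kk; rewrite gk -g0 kE => -[].
    by rewrite h3.
Qed.

End Cells.

Local Open Scope nat_scope.

(** The left side is the value of [E * l + 2] for the parameters of [size_diagonal_words_head]: [E]
    and [l] are linear in [m]. *)
Lemma shell_count_bound K D m : 0 < m ->
  4 * K * (K * m.*2 + 1) * (1 + 2 * (K * m.*2 + 1) + 4 * m * D) + 2 <=
  m ^ 2 * (12 * (K * (3 * K + 1)) * (3 + 6 * K + 4 * D) + 2).
Proof.
move=> m0; rewrite -mul2n.
have h1 : 4 * K * (K * (2 * m) + 1) <= m * (12 * (K * (3 * K + 1))).
  have -> : m * (12 * (K * (3 * K + 1))) = 4 * K * (m * (9 * K + 3)) by ring.
  rewrite leq_mul2l; apply/orP; right.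
  have -> : m * (9 * K + 3) = K * (2 * m) + (7 * (K * m) + 3 * m) by ring.
  by rewrite leq_add2l (leq_trans _ (leq_addl _ _)) // muln_gt0.
have h2 : 1 + 2 * (K * (2 * m) + 1) + 4 * m * D <= m * (3 + 6 * K + 4 * D).
  have -> : m * (3 + 6 * K + 4 * D) = 3 * m + (6 * (K * m) + 4 * m * D) by ring.
  have -> : 1 + 2 * (K * (2 * m) + 1) + 4 * m * D = 3 * 1 + (4 * (K * m) + 4 * m * D).
    by ring.
  by rewrite leq_add // ?leq_mul // leq_add2r leq_mul.
have h3 : 2 <= m ^ 2 * 2 by rewrite leq_pmull // expn_gt0 m0.
apply: leq_trans (leq_add (leq_mul h1 h2) h3) _.
by apply: eq_leq; ring.
Qed.

Local Open Scope ring_scope.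

Section Recursion.
Variable R : realType.
Local Notation V := 'rV[R]_2.
Implicit Types (u v : V).
Variable P : 'I_3 -> V.
Hypothesis P0 : area P != 0.
Local Notation h := (foot P).
Local Notation diagonal := (diagonal h).
Local Notation gap_vector := (gap_vector h P).
Local Notation direction := (direction h P).
Local Notation slope := (slope P).

Definition words n : seq (seq 'I_3) := [seq val w | w <- enum {: n.-bseq 'I_3}].

Definition diagonal_words n := [seq w <- words n | diagonal P w].

Lemma mem_words n w : (w \in words n) = (size w <= n)%N.
Proof.
apply/mapP/idP => [[b _ ->]|wn]; first exact: size_bseq.
by exists (Bseq wn); rewrite ?mem_enum.
Qed.

Lemma uniq_diagonal_words n : uniq (diagonal_words n).
Proof. by rewrite filter_uniq // map_inj_uniq ?enum_uniq //; apply: val_inj. Qed.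

Lemma mem_diagonal_words n w :
  (w \in diagonal_words n) = diagonal P w && (size w <= n)%N.
Proof. by rewrite mem_filter mem_words. Qed.

Variable D : nat.
Hypothesis D_gt0 : (0 < D)%N.
Hypothesis D_int : forall i, D%:R * (2 * h i) \is a Num.int.

Lemma size_diagonal_words_head : exists K : nat, forall m a, (0 < m)%N ->
  (size [seq w <- diagonal_words m.*2 | head 0%R w == a] <=
   4 * ((m.*2).+1 ^ 3 * (m.*2).+1 ^ 3 * 2 * (9 + size (diagonal_words m)) * 2 *
     (4 * K * (K * m.*2 + 1) * (1 + 2 * (K * m.*2 + 1) + 4 * m * D) + 2)))%N.
Proof.
have [K [K0 KP]] := isometry_bound P0.
have [psi psiP] := unfold_isometry P0.
exists K => m a m0.
(* [M] bounds the levels and [c = 1 / K]. With this [E], a cell of width at most [1 / E] is [short],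
   and [E - 1 >= 2 * M * K + 2] gives [away]. By [n <= 2 ^ n], the [l] below satisfies
   [2 * M ^ 2 * D ^ (4 * m) <= 2 ^ l]. *)
set M := (K * m.*2 + 1)%N; set E := (4 * K * M)%N.
set l := (1 + 2 * M + 4 * m * D)%N.
pose X : finType :=
  ({ffun 'I_3 -> 'I_(m.*2).+1} * {ffun 'I_3 -> 'I_(m.*2).+1} * bool)%type.
pose G : seq V := [seq P jj.2 - P jj.1 | jj <- enum {: 'I_3 * 'I_3}] ++
  [seq direction w | w <- diagonal_words m].
pose vec (e : X) v := isometry
  (\sum_i ((e.1.1 i)%:R - (e.1.2 i)%:R) * psi i) e.2 v.
(* The default 0 is the slope of the side [P (a + 1) - P a], itself a gap vector, so [Y] contains
   only slopes of gap vectors. *)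
pose Y := [seq (if `[< gap_vector m (vec e v) >] then slope a (vec e v) else 0)
  | e <- enum X, v <- G].
have sY : size Y =
    ((m.*2).+1 ^ 3 * (m.*2).+1 ^ 3 * 2 * (9 + size (diagonal_words m)))%N.
  have sX : size (enum X) = ((m.*2).+1 ^ 3 * (m.*2).+1 ^ 3 * 2)%N.
    by rewrite -(cardT X) /X !card_prod card_bool !card_ffun !card_ord.
  have sG : size G = (9 + size (diagonal_words m))%N.
    rewrite size_cat !size_map; congr (_ + _)%N.
    have <- : #|{: 'I_3 * 'I_3}| = 9%N by rewrite card_prod card_ord.
    by rewrite cardE enumT.
  by rewrite size_allpairs sX sG.
have gapY v : gap_vector m v -> slope a v \in Y.
  move=> g; have [e [e' [b [v' [E1 H]]]]] := gap_vector_isometry psiP g.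
  apply/allpairsP; exists ((e, e', b) : X, v'); split; rewrite ?mem_enum //=.
    rewrite mem_cat; apply/orP; case: H => [[j1 [j2 [_ ->]]]|[w [sw dw ->]]].
      by left; apply/mapP; exists (j1, j2); rewrite ?mem_enum.
    by right; apply/mapP; exists w; rewrite // mem_diagonal_words dw.
  by rewrite /vec /= -E1; case: asboolP.
have g0 : gap_vector m (P (a + 1) - P a).
  by left; exists [::], a, (a + 1); rewrite eq_sym I3_neq.
have s0 : slope a (P (a + 1) - P a) = 0.
  by rewrite !/(slope _ _) /coord2 (_ : cross _ _ = 0) ?mul0r // /cross; ring.
have Yv y : y \in Y -> exists2 v, gap_vector m v & y = slope a v.
  move=> /allpairsP[[e v] [_ _ ->]] /=; case: asboolP => [g|_].
    by exists (vec e v).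
  by exists (P (a + 1) - P a).
have ME : M%:R = K%:R * (m.*2)%:R + 1 :> R by rewrite natrD natrM.
have K1 : 1 <= K%:R :> R by rewrite ler1n.
have M3 : 3 <= M%:R :> R.
  rewrite (ler_nat _ 3) /M addn1 ltnS -[2%N]mul1n leq_mul //.
  by rewrite -[2%N]/(1.*2) leq_double.
have EE : E%:R = 4 * K%:R * M%:R :> R by rewrite !natrM.
rewrite -sY; apply: (count_cells (x := dslope h P) (Y := Y)).
- by rewrite !muln_gt0 K0 /= /M addn1.
- by rewrite filter_uniq // uniq_diagonal_words.
- by rewrite -s0; apply: gapY.
- move=> w; rewrite mem_filter mem_diagonal_words => /and3P[_ dw _].
  exact: dslope_itv.
- move=> w y; rewrite mem_filter mem_diagonal_words => /and3P[/eqP wa dw sw].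
  move=> /Yv[v g ->]; rewrite -wa => ne.
  apply: le_trans (slope_separation P0 KP D_gt0 D_int dw sw g ne).
  rewrite lef_pV2 ?posrE ?exprn_gt0 -?ME //; last first.
    by rewrite !mulr_gt0 ?exprn_gt0 ?ltr0n // /M addn1.
  rewrite -!natrX -!natrM ler_nat.
  have lt2 n : (n <= 2 ^ n)%N by apply: ltnW; apply: ltn_expl.
  have -> : (2 ^ l = 2 * 2 ^ (2 * M) * 2 ^ (4 * m * D))%N by rewrite /l !expnD.
  apply: leq_mul.
    by rewrite leq_mul2l /= mulnC expnM leq_exp2r ?lt2.
  have -> : (4 * m * D = D * (m.*2 + m.*2))%N by rewrite -!mul2n; ring.
  by rewrite expnM leq_exp2r ?lt2 // addnn !double_gt0.
- move=> p q pq qpE away L' uL' sL' HL'.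
  have E0 : 0 < E%:R :> R by rewrite ltr0n !muln_gt0 K0 /= /M addn1.
  have qpE' : E%:R * (q - p) <= 1.
    by rewrite -(@ler_pM2l _ E%:R) // divff ?gt_eqF // in qpE.
  have KK : K%:R * K%:R^-1 = 1 :> R by rewrite divff // gt_eqF //; lra.
  apply: (@in_cell_card _ h P P0 m a (K%:R^-1) M%:R p q) => //.
  - by rewrite invr_gt0 ltr0n.
  - lra.
  - move=> w dw sw; apply: le_trans (le_trans (ler_norm _) (level_le_norm _ _ _)) _.
    apply: le_trans (direction_norm P0 KP dw) _.
    by rewrite ME lerD2r ler_wpM2l ?ler_nat //; lra.
  - by move=> v g; apply: (gap_vector_ge P0 K0 KP a g).
  - rewrite -(@ler_pM2l _ K%:R) ?KK; last by lra.
    by move: qpE'; rewrite EE; lra.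
  - move=> v g; apply: le_trans (away _ (gapY _ g)).
    rewrite invrK ler_wpM2r ?subr_ge0 // EE.
    have : 3 * 1 <= M%:R * K%:R :> R by rewrite ler_pM.
    lra.
  - move=> w wL; have := sL' _ wL.
    rewrite mem_filter mem_diagonal_words => /and3P[/eqP wa dw sw].
    by split=> //; apply: HL'.
Qed.

(** The power 8 is 6 for the linear parts plus 2 for the shells. The 9 counts the differences of two
    vertices in [Y]; adding it on the left as well makes the recursion homogeneous. *)
Lemma size_diagonal_words_double : exists C : nat, forall m, (0 < m)%N ->
  (size (diagonal_words m.*2) + 9 <= C * m ^ 8 * (size (diagonal_words m) + 9))%N.
Proof.
have [K H] := size_diagonal_words_head.
exists (3 * (4 * (3 ^ 6 * 2 * 2 * (12 * (K * (3 * K + 1)) * (3 + 6 * K + 4 * D) + 2))) + 1)%N.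
move=> m m0.
set N := size (diagonal_words m).
have sum : (size (diagonal_words m.*2) <=
    \sum_a size [seq w <- diagonal_words m.*2 | head 0%R w == a])%N.
  elim: (diagonal_words m.*2) => [//|w L IH].
  rewrite (bigD1 (head 0%R w)) //= eqxx /= addSn ltnS (leq_trans IH) //.
  rewrite (bigD1 (head 0%R w)) //= leq_add2l leq_sum // => a /negbTE.
  by rewrite eq_sym => ->.
have {sum} := leq_trans sum (leq_sum _ (fun a _ => H m a m0)).
rewrite sum_nat_const card_ord; set B := (_ * (_ + 2))%N.
have B1 : (B <= 3 ^ 6 * m ^ 6 * 2 * (N + 9) * 2 *
    (m ^ 2 * (12 * (K * (3 * K + 1)) * (3 + 6 * K + 4 * D) + 2)))%N.
  rewrite /B; apply: leq_mul.
    rewrite -expnD -expnMn [(9 + _)%N]addnC !leq_mul2r /=.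
    have : ((m.*2).+1 <= 3 * m)%N by lia.
    by move=> h1; apply/orP; right; rewrite leq_exp2r.
  exact: shell_count_bound.
set W := (12 * _ * _ + 2)%N in B1 *.
move=> H1; have H2 : (size (diagonal_words m.*2) <=
    3 * (4 * (3 ^ 6 * 2 * 2 * W)) * m ^ 8 * (N + 9))%N.
  apply: (leq_trans H1).
  apply: (@leq_trans (3 * (4 * (3 ^ 6 * m ^ 6 * 2 * (N + 9) * 2 * (m ^ 2 * W))))%N).
    by rewrite !leq_mul2l B1 !orbT.
  apply: eq_leq; move: (3 ^ 6)%N => c; ring.
have H3 : (9 <= m ^ 8 * (N + 9))%N.
  by rewrite -[9%N]mul1n leq_mul ?expn_gt0 ?m0 // leq_addl.
rewrite mulnDl mul1n mulnDl; exact: leq_add.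
Qed.

End Recursion.

(** * From billiard trajectories to words *)

Section Folding.
Variable R : realType.
Local Notation V := 'rV[R]_2.
Implicit Types (u v x y z p d O : V) (T : 'I_3 -> V) (w : seq 'I_3).
Variable P : 'I_3 -> V.
Hypothesis P0 : area P != 0.
Local Notation h := (foot P).
Local Notation unfold := (unfold h).
Local Notation tip := (tip h).
Local Notation diagonal := (diagonal h).
Local Notation crosses := (crosses h).
Local Notation direction := (direction h P).

(* Proportional to the distance from [x] to the side [i]. *)
Definition depth i x : R := area P * cross (P (i + 2) - P (i + 1)) (x - P (i + 1)).

Lemma depth_affine i (t : R) x y :
  depth i ((1 - t) *: x + t *: y) = (1 - t) * depth i x + t * depth i y.
Proof. by rewrite /depth /cross !mxE; ring. Qed.

Lemma depth_vertex i j : i != j -> depth i (P j) = 0.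
Proof.
have [->|->|->] := I3_cases i j; rewrite ?eqxx // /depth /cross !mxE => _; ring.
Qed.

Lemma depth_side i p : open_side P i p -> depth i p = 0.
Proof.
by move=> [t [_ ->]]; rewrite depth_affine !depth_vertex ?mulr0 ?addr0 //
  eq_sym I3_neq.
Qed.

Lemma sum3 (F : 'I_3 -> V) i : \sum_j F j = F i + F (i + 1) + F (i + 2).
Proof.
rewrite (bigD1 i) //= (bigD1 (i + 1)) ?I3_neq //= (bigD1 (i + 2)) /=; last first.
  by rewrite I3_neq /= eq_sym I3_neq.
rewrite big1 => [|j]; first by rewrite addr0 addrA.
by have [->|->|->] := I3_cases i j; rewrite !eqxx ?andbF.
Qed.

Lemma sum3R (F : 'I_3 -> R) i : \sum_j F j = F i + F (i + 1) + F (i + 2).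
Proof.
rewrite (bigD1 i) //= (bigD1 (i + 1)) ?I3_neq //= (bigD1 (i + 2)) /=; last first.
  by rewrite I3_neq /= eq_sym I3_neq.
rewrite big1 => [|j]; first by rewrite addr0 addrA.
by have [->|->|->] := I3_cases i j; rewrite !eqxx ?andbF.
Qed.

Lemma depth_gt0 i x : open_triangle P x -> 0 < depth i x.
Proof.
move=> [a [a0 a1 ->]]; rewrite (sum3 _ i).
have E : a (i + 1) = 1 - a i - a (i + 2) by rewrite -a1 (sum3R _ i); ring.
have -> : depth i (a i *: P i + a (i + 1) *: P (i + 1) + a (i + 2) *: P (i + 2)) =
    a i * area P ^+ 2.
  rewrite /depth E expr2 mulrCA; congr (_ * _).
  by rewrite (areaE P i) /cross !mxE; ring.
by rewrite mulr_gt0 // lt_neqAle sqr_ge0 eq_sym sqrf_eq0 P0.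
Qed.

Lemma leg_depth i x y : (open_segment x y `<=` open_triangle P)%classic ->
  0 < depth i x + depth i y.
Proof.
move=> H; have : open_segment x y ((1 - 2^-1) *: x + 2^-1 *: y).
  by exists 2^-1; split => //; lra.
by move=> /H /(depth_gt0 i); rewrite depth_affine; lra.
Qed.

Lemma dot_isometry phi b u v : dot (isometry phi b u) (isometry phi b v) = dot u v.
Proof.
rewrite !dotE !mxE /=.
have -> : u 0 0 * v 0 0 + u 0 1 * v 0 1 = (cos phi ^+ 2 + sin phi ^+ 2) *
  (u 0 0 * v 0 0 + ((-1) ^+ b) ^+ 2 * (u 0 1 * v 0 1)).
  by rewrite cos2Dsin2 mul1r sqrr_sign mul1r.
ring.
Qed.

Lemma lagrange u v : dot u v ^+ 2 + cross u v ^+ 2 = dot u u * dot v v.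
Proof. by rewrite !dotE /cross; ring. Qed.

Lemma euclid_norm_gt0 v : v != 0 -> 0 < euclid_norm v.
Proof. by move=> v0; rewrite /euclid_norm sqrtr_gt0 dot_gt0. Qed.

Lemma euclid_norm_sqr v : euclid_norm v ^+ 2 = dot v v.
Proof. by rewrite sqr_sqrtr // dotE -!expr2 addr_ge0 ?sqr_ge0. Qed.

Lemma euclid_normZ (t : R) v : euclid_norm (t *: v) = `|t| * euclid_norm v.
Proof.
rewrite /euclid_norm (_ : dot _ _ = t ^+ 2 * dot v v); last first.
  by rewrite !dotE !mxE; ring.
by rewrite sqrtrM ?sqr_ge0 // sqrtr_sqr.
Qed.

Lemma cos_angle_itv u v : u != 0 -> v != 0 ->
  -1 <= dot u v / (euclid_norm u * euclid_norm v) <= 1.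
Proof.
move=> u0 v0; have n0 : 0 < euclid_norm u * euclid_norm v.
  by rewrite mulr_gt0 // euclid_norm_gt0.
rewrite -ler_norml normrM normfV (gtr0_norm n0) ler_pdivrMr // mul1r.
rewrite -(@ler_pXn2r _ 2) // ?nnegrE ?(ltW n0) // real_normK ?num_real //.
by rewrite exprMn !euclid_norm_sqr -lagrange lerDl sqr_ge0.
Qed.

Lemma dot_cross_eq e u v : e != 0 -> dot u e = dot v e -> cross u e = cross v e ->
  u = v.
Proof.
move=> e0 de ce; have ee : dot e e != 0 by rewrite gt_eqF // dot_gt0.
have : dot e e *: u = dot e e *: v.
  apply: rowP2; rewrite !mxE.
  - have E z : dot e e * z 0 0 = dot z e * e 0 0 + cross z e * e 0 1 :> R.
      by rewrite !dotE /cross; ring.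
    by rewrite !E de ce.
  - have E z : dot e e * z 0 1 = dot z e * e 0 1 - cross z e * e 0 0 :> R.
      by rewrite !dotE /cross; ring.
    by rewrite !E de ce.
by move/(scalerI ee).
Qed.

(* The two rays make the same angle with the line of the side and lie on the
   same side of it, so the mirror image of one prolongs the other. *)
Lemma reflection_straight i psi x p y :
  (forall j k, flip h i P j - flip h i P k = isometry psi true (P j - P k)) ->
  open_side P i p -> angle x p (P (i + 1)) = angle y p (P (i + 2)) ->
  0 < depth i x -> 0 < depth i y ->
  exists2 t : R, 0 < t & isometry psi true (y - p) = t *: (p - x).
Proof.
move=> psiP [s [/andP[s0 s1] pE]] ang dx dy.
set e := P (i + 2) - P (i + 1).
have e0 : e != 0 by apply: side_neq0.
have n0 : 0 < euclid_norm e by apply: euclid_norm_gt0.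
have Ae : P (i + 1) - p = (- s) *: e by apply: rowP2; rewrite pE /e !mxE; ring.
have Be : P (i + 2) - p = (1 - s) *: e by apply: rowP2; rewrite pE /e !mxE; ring.
set u := x - p; set v := y - p.
have dE z : depth i z = area P * cross e (z - p).
  by rewrite /depth -/e /cross pE /e !mxE; ring.
have cu : 0 < area P * cross e u by rewrite -dE.
have cv : 0 < area P * cross e v by rewrite -dE.
have u0 : u != 0.
  by apply: contraTneq cu => ->; rewrite /cross !mxE !mulr0 subrr mulr0 ltxx.
have v0 : v != 0.
  by apply: contraTneq cv => ->; rewrite /cross !mxE !mulr0 subrr mulr0 ltxx.
have nu := euclid_norm_gt0 u0; have nv := euclid_norm_gt0 v0.
have dots : dot v e / euclid_norm v = - (dot u e / euclid_norm u).
  have := congr1 cos ang; rewrite /angle Ae Be -/u -/v.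
  have s0' : - s != 0 by rewrite oppr_eq0 gt_eqF.
  have s1' : 1 - s != 0 by rewrite gt_eqF // subr_gt0.
  rewrite !acosK; last 2 first.
  - by rewrite in_itv /=; apply: cos_angle_itv; rewrite // scaler_eq0 negb_or s1'.
  - by rewrite in_itv /=; apply: cos_angle_itv; rewrite // scaler_eq0 negb_or s0'.
  have dZ (t : R) z : dot z (t *: e) = t * dot z e by rewrite !dotE !mxE; ring.
  rewrite !dZ !euclid_normZ normrN (gtr0_norm s0) (gtr0_norm (_ : 0 < 1 - s)) ?subr_gt0 //.
  move=> H.
  have H1 : - s * dot u e / (euclid_norm u * (s * euclid_norm e)) =
     - (dot u e / euclid_norm u) / euclid_norm e.
    by field; rewrite !gt_eqF.
  have H2 : (1 - s) * dot v e / (euclid_norm v * ((1 - s) * euclid_norm e)) =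
     dot v e / euclid_norm v / euclid_norm e.
    by field; rewrite !gt_eqF // subr_gt0.
  rewrite H1 H2 in H; apply: (mulIf (_ : (euclid_norm e)^-1 != 0)).
    by rewrite invr_neq0 // gt_eqF.
  by rewrite -H.
set t := euclid_norm v / euclid_norm u.
have t0 : 0 < t by rewrite divr_gt0.
have dv : dot v e = - t * dot u e.
  have -> : dot v e = dot v e / euclid_norm v * euclid_norm v.
    by rewrite divfK // gt_eqF.
  by rewrite dots /t; ring.
have cve : cross v e = t * cross u e.
  have sq : cross v e ^+ 2 = (t * cross u e) ^+ 2.
    have L1 := lagrange v e; have L2 := lagrange u e.
    have Nv : dot v v = t ^+ 2 * dot u u.
      rewrite -!euclid_norm_sqr /t; field; by rewrite gt_eqF.
    rewrite Nv dv in L1; rewrite exprMn.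
    have -> : cross u e ^+ 2 = dot u u * dot e e - dot u e ^+ 2 by rewrite -L2; ring.
    have -> : cross v e ^+ 2 = t ^+ 2 * dot u u * dot e e - (- t * dot u e) ^+ 2.
      by rewrite -L1; ring.
    ring.
  have /eqP := sq; rewrite eqf_sqr => /orP[/eqP //|/eqP H].
  exfalso; have : 0 < area P * cross e v by [].
  have -> : cross e v = - cross v e by rewrite /cross; ring.
  rewrite H opprK.
  have -> : area P * (t * cross u e) = - (t * (area P * cross e u)).
    by rewrite /cross; ring.
  by rewrite oppr_gt0 ltNge (ltW (mulr_gt0 t0 cu)).
exists t => //; apply: (dot_cross_eq e0).
  have Re : isometry psi true e = e.
    by rewrite /e -psiP flip2 flip1.
  rewrite -{1}Re dot_isometry -/v dv -opprB -/u !dotE !mxE; ring.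
have Re : isometry psi true e = e by rewrite /e -psiP flip2 flip1.
rewrite -{1}Re cross_isometry -/v cve -opprB -/u /cross !mxE /=; ring.
Qed.

Definition trajectory (s : seq V) : Prop :=
  (forall k, (k.+1 < size s)%N ->
    (open_segment s`_k s`_k.+1 `<=` open_triangle P)%classic) /\
  (forall k, (k.+2 < size s)%N -> reflects P s`_k s`_k.+1 s`_k.+2).

Lemma trajectory_behead x s : trajectory (x :: s) -> trajectory s.
Proof.
by move=> [h1 h2]; split=> k ks; [apply: (h1 k.+1)|apply: (h2 k.+1)].
Qed.

(** The point where the ray crosses the side [i] of [T], carried back to the side [i] of [P] with
    the same barycentric coordinates. *)
Definition gate_point O d T i : V :=
  let x := cross d (T (i + 1) - O) in let y := cross d (T (i + 2) - O) in
  (1 - x / (x - y)) *: P (i + 1) + (x / (x - y)) *: P (i + 2).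

Fixpoint gate_points O d T w : seq V :=
  if w is i :: w' then gate_point O d T i :: gate_points O d (flip h i T) w'
  else [::].

(* [g] is the map unfolding the current copy of the triangle onto [T]. *)
Lemma trace g phi b T O d (t mu : R) p p' s j :
  (forall x y, g x - g y = isometry phi b (x - y)) ->
  (forall j, g (P j) = T j) ->
  g p - O = t *: d -> 0 <= t -> g p' - g p = mu *: d -> 0 < mu ->
  trajectory [:: p, p' & s] -> last p' s = P j ->
  exists w, [/\ size w = size s, crosses O d T w,
    p' :: s = rcons (gate_points O d T w) (P j),
    exists2 t', 0 < t' & unfold T w j - O = t' *: d &
    w != [::] -> j = last 0 w].
Proof.
elim: s g phi b T p p' t mu => [|p'' s IH] g phi b T p p' t mu gI gP pt t0 pmu mu0.
  move=> _ /= p'j; exists [::]; split=> //=; first by rewrite p'j.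
  exists (t + mu); first by rewrite ltr_wpDl.
  by rewrite -gP -p'j scalerDl -pt -pmu [RHS]addrC addrA subrK.
move=> tr lst; case: (tr) => h1 h2.
have [i p'i ang] := h2 0%N isT; rewrite /= in p'i ang.
have leg1 := h1 0%N isT; have leg2 := h1 1%N isT; rewrite /= in leg1 leg2.
have dp' := depth_side p'i.
have dp : 0 < depth i p by have := leg_depth i leg1; rewrite dp' addr0.
have dp'' : 0 < depth i p'' by have := leg_depth i leg2; rewrite dp' add0r.
have [psi psiP] := flip_isometry P0 i.
have [la la0 straight] := reflection_straight psiP p'i ang dp dp''.
(* The next unfolding map: first reflect in the side [i] of [P], then apply [g]. It agrees with [g]
   at [p'] and straightens the next leg. *)
pose g' x := g (P (i + 1) + isometry psi true (x - P (i + 1))).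
have [s0 [/andP[s00 s01] p'E]] := p'i.
have g'I x y : g' x - g' y = isometry (phi + (-1) ^+ b * psi) (~~ b) (x - y).
  rewrite /g' gI -addbT -isometry_comp; congr isometry.
  by rewrite opprD addrACA subrr add0r -isometryB opprB addrA subrK.
have gflip k : g (flip h i P k) = flip h i T k.
  have E := @unfold_map_base _ h _ P T (P i) (T i) [:: i] k
     (isometry_lin phi b) _.
  have /E /= {}E : forall j', T j' - T i = isometry phi b (P j' - P i).
    by move=> j'; rewrite -!gP gI.
  by have := gI (flip h i P k) (P i); rewrite -E gP => /addIr.
have g'P k : g' (P k) = flip h i T k.
  rewrite -gflip /g'; congr g.
  have := psiP k (i + 1); rewrite flip1 => <-.
  by rewrite addrC subrK.
have Re : isometry psi true (P (i + 2) - P (i + 1)) = P (i + 2) - P (i + 1).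
  by rewrite -psiP flip2 flip1.
have g'p' : g' p' = g p'.
  rewrite /g'; congr g.
  have -> : p' - P (i + 1) = s0 *: (P (i + 2) - P (i + 1)) + 0 *: 0.
    by rewrite p'E; apply: rowP2; rewrite !mxE; ring.
  by rewrite isometry_lin Re p'E; apply: rowP2; rewrite !mxE; ring.
have p'O : g' p' - O = (t + mu) *: d.
  by rewrite g'p' scalerDl -pt -pmu [RHS]addrC addrA subrK.
have p''d : g' p'' - g' p' = (la * mu) *: d.
  rewrite /g' gI opprD addrACA subrr add0r -isometryB.
  have -> : p'' - P (i + 1) - (p' - P (i + 1)) = p'' - p'.
    by rewrite opprB addrA subrK.
  rewrite straight -scalerA -pmu gI.
  by have := isometry_lin phi b la 0 (p' - p) 0; rewrite !scale0r !addr0.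
have [w [sw cw pw [t' t'0 tw] lw]] :=
  IH g' _ _ (flip h i T) p' p'' _ _ g'I g'P p'O
    (addr_ge0 t0 (ltW mu0)) p''d (mulr_gt0 la0 mu0) (trajectory_behead tr) lst.
have mun : mu != 0 by rewrite gt_eqF.
have xE k : cross d (T k - O) = mu^-1 * ((-1) ^+ b * cross (p' - p) (P k - p')).
  rewrite -(cross_isometry phi b) -!gI gP pmu.
  have -> : T k - O = (T k - g p') + (t + mu) *: d.
    by rewrite -p'O g'p' addrA subrK.
  by rewrite /cross !mxE; field.
have aE : area T = (-1) ^+ b * area P.
  by rewrite /area -!gP !gI cross_isometry.
have e1 : cross (p' - p) (P (i + 1) - p') = - s0 * cross (P (i + 2) - P (i + 1)) (p - P (i + 1)).
  by rewrite p'E /cross !mxE; ring.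
have e2 : cross (p' - p) (P (i + 2) - p') = (1 - s0) * cross (P (i + 2) - P (i + 1)) (p - P (i + 1)).
  by rewrite p'E /cross !mxE; ring.
rewrite /depth in dp; set C := cross (P (i + 2) - P (i + 1)) (p - P (i + 1)) in dp e1 e2.
have C0 : C != 0 by apply: contraTneq dp => ->; rewrite mulr0 ltxx.
have sg : (-1) ^+ b * (-1) ^+ b = 1 :> R by rewrite -expr2 sqrr_sign.
have g1 : gate O d T i.
  rewrite /gate !xE aE e1 e2.
  have E (c : R) : (-1) ^+ b * area P * (mu^-1 * ((-1) ^+ b * (c * C))) =
    ((-1) ^+ b * (-1) ^+ b) * (mu^-1 * (area P * C) * c) by ring.
  have m0 : 0 < mu^-1 * (area P * C) by rewrite mulr_gt0 // invr_gt0.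
  rewrite !E sg !mul1r pmulr_rlt0 // pmulr_rgt0 //.
  by rewrite oppr_lt0 s00 subr_gt0.
exists (i :: w); split=> //=.
- by rewrite sw.
- by rewrite g1.
- rewrite -pw; congr (_ :: _); rewrite /gate_point !xE e1 e2 {1}p'E.
  suff -> : mu^-1 * ((-1) ^+ b * (- s0 * C)) /
     (mu^-1 * ((-1) ^+ b * (- s0 * C)) - mu^-1 * ((-1) ^+ b * ((1 - s0) * C))) = s0.
    by [].
  field; rewrite mun /=.
  have -> : (-1) ^+ b * (- s0 * C) - (-1) ^+ b * ((1 - s0) * C) =
    - ((-1) ^+ b * C) by ring.
  by rewrite oppr_eq0 mulf_neq0 // signr_eq0.
- by exists t'.
(* The last leg starts on the side [i]; lying in the open triangle, it can end only at the vertex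
   opposite to that side. *)
move=> _; case: w lw sw {cw pw tw} => [_|k w lw _]; last exact: lw.
case: s lst {IH tr h1 h2} => //= lst _.
have := leg_depth i leg2; rewrite dp' add0r lst.
have [//|ij] := eqVneq j i; by rewrite depth_vertex ?ltxx // eq_sym.
Qed.

Definition fold_word w : seq V :=
  P (head 0 w) ::
    rcons (gate_points (P (head 0 w)) (direction w) P w) (P (last 0 w)).

Lemma gate_points_scale O d T w (t : R) : 0 < t ->
  gate_points O (t *: d) T w = gate_points O d T w.
Proof.
move=> t0; have tn : t != 0 by rewrite gt_eqF.
elim: w T => //= i w IH T; rewrite IH; congr (_ :: _).
rewrite /gate_point; set x := cross d _; set y := cross d _.
have E X : cross (t *: d) X = t * cross d X by rewrite /cross !mxE; ring.
by rewrite !E -/x -/y -mulrBr -mulf_div divff // mul1r.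
Qed.

Lemma crosses_scale O d T w (t : R) : 0 < t ->
  crosses O (t *: d) T w = crosses O d T w.
Proof.
move=> t0; elim: w T => //= i w IH T; rewrite IH; congr (_ && _).
have E X : area T * cross (t *: d) X = t * (area T * cross d X).
  by rewrite /cross !mxE; ring.
by rewrite /gate !E pmulr_rlt0 // pmulr_rgt0.
Qed.

Lemma third_index (i j : 'I_3) : exists k, k != i /\ k != j.
Proof.
have [->|->|->] := I3_cases i j.
- by exists (i + 1); rewrite I3_neq.
- by exists (i + 2); rewrite I3_neq eq_sym I3_neq.
- by exists (i + 1); rewrite !I3_neq.
Qed.

(** A generalized diagonal is recovered from its word by folding, so counting words bounds the
    complexity. *)
Lemma generalized_diagonal_word s : generalized_diagonal P s ->
  exists w, [/\ diagonal P w, (size w = size s - 2)%N & s = fold_word w].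
Proof.
move=> [sz [a sa] [j sj] legs refl].
case: s sz sa sj legs refl => [|p [|p' s]] //= _ pa sj legs refl.
have tr : trajectory [:: p, p' & s] by [].
have lst : last p' s = P j by rewrite -sj (last_nth 0).
have leg1 := legs 0%N isT; rewrite /= in leg1.
rewrite {}pa in tr leg1 legs refl *.
have [w [sw cw pw [t' t'0 tw] lw]] := @trace id 0 false P (P a) (p' - P a) 0 1
  (P a) p' s j (fun x y => esym (isometry0 _)) (fun=> erefl)
  (etrans (subrr _) (esym (scale0r _))) (lexx _) (esym (scale1r _)) ltr01 tr lst.
case: w sw cw pw tw lw => [|i w] sw cw pw tw lw.
  (* Without reflections the leg would join two vertices along a side. *)
  exfalso; case: s sw lst {tr sj legs refl pw} => //= _ p'j.
  have [k [ka kj]] := third_index a j.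
  have := leg_depth k leg1; rewrite p'j !depth_vertex ?addr0 ?ltxx //.
have {}lw := lw isT.
(* A leg from [P a] to a side containing [P a] would run along that side. *)
have ai : i = a.
  have [//|ia] := eqVneq i a.
  have := leg_depth i leg1; rewrite (depth_vertex ia) add0r.
  move: pw => /= [-> _]; rewrite /gate_point /= depth_affine !depth_vertex;
    by rewrite ?mulr0 ?addr0 ?ltxx // eq_sym I3_neq.
subst a; exists (i :: w).
have dE : direction (i :: w) = t' *: (p' - P i) by rewrite -tw lw.
split.
- change (crosses (P i) (direction (i :: w)) P (i :: w)).
  by rewrite dE crosses_scale.
- by rewrite sw /= subn2.
- by rewrite /fold_word dE gate_points_scale // pw lw.
Qed.

End Folding.

(** * The growth of the complexity *)

Section Triangle.
Variable R : realType.
Local Notation V := 'rV[R]_2.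
Variable P : 'I_3 -> V.

Lemma nondegenerate_area : nondegenerate P -> area P != 0.
Proof.
rewrite /nondegenerate /area; set u := P 1 - P 0; set v := P 2 - P 0.
clearbody u v => free; apply/eqP => c0.
have dep (a b : R) : a *: u + b *: v = 0 -> a = 0 /\ b = 0.
  move=> ab; have : row_mx a%:M b%:M *m col_mx u v = (0 : 'M[R]_(1, 1 + 1)) *m col_mx u v.
    by rewrite mul_row_col !mul_scalar_mx ab mul0mx.
  move/(row_free_inj free); rewrite -[0]row_mx0 => /eq_row_mx[/matrixP ea /matrixP eb].
  have := ea 0 0; have := eb 0 0; by rewrite !mxE !eqxx !mulr1n.
have [v1 u1] : v 0 1 = 0 /\ - u 0 1 = 0.
  apply: dep; apply: rowP2; rewrite !mxE; last by ring.
  by rewrite -[RHS]c0 /cross; ring.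
have [v0 u0] : v 0 0 = 0 /\ - u 0 0 = 0.
  apply: dep; apply: rowP2; rewrite !mxE; first by ring.
  by rewrite -[RHS](oppr0) -[in RHS]c0 /cross; ring.
have [/eqP] : (1 : R) = 0 /\ (0 : R) = 0; last by rewrite oner_eq0.
apply: dep; apply: rowP2; rewrite !mxE ?v0 ?v1 mulr0 addr0 mul1r.
- by apply: oppr_inj; rewrite u0 oppr0.
- by apply: oppr_inj; rewrite u1 oppr0.
Qed.

Hypothesis P0 : area P != 0.

(** The foot is at distance [|P (i + 2) - P i| * cos] of the angle at [P (i + 2)] from that vertex,
    and the law of sines gives the ratio of the two side lengths. This turns trigonometric
    rationality into rational flips. *)
Lemma foot_angles i : foot P i =
  cos (interior_angle P (i + 2)) * sin (interior_angle P (i + 1)) /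
    sin (interior_angle P i).
Proof.
pose n j k := euclid_norm (P j - P k).
have neq j k : j != k -> P j - P k != 0.
  move=> jk; have : coord_norm P k (P j - P k) != 0.
    by rewrite coord_norm_side ?oner_eq0 // eq_sym.
  apply: contraNneq => ->; rewrite /coord_norm /coord1 /coord2.
  by rewrite /cross !mxE !(mul0r, mulr0) subrr !mul0r normr0 addr0.
have n0 j k : j != k -> n j k != 0.
  by move=> jk; rewrite gt_eqF // euclid_norm_gt0 // neq.
have nC j k : n j k = n k j.
  rewrite /n -opprB -scaleN1r euclid_normZ normrN normr1 mul1r //.
have cosE j : cos (interior_angle P j) =
    dot (P (j + 1) - P j) (P (j + 2) - P j) / (n (j + 1) j * n (j + 2) j).
  by rewrite /interior_angle /angle acosK // in_itv /=; apply: cos_angle_itv;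
    apply: neq; rewrite I3_neq.
have sinE j : sin (interior_angle P j) = `|area P| / (n (j + 1) j * n (j + 2) j).
  have itv : -1 <= dot (P (j + 1) - P j) (P (j + 2) - P j) /
      (n (j + 1) j * n (j + 2) j) <= 1.
    by apply: cos_angle_itv; apply: neq; rewrite I3_neq.
  have N0 : n (j + 1) j * n (j + 2) j != 0 by rewrite mulf_neq0 // n0 // I3_neq.
  rewrite /interior_angle /angle sin_acos //.
  rewrite -[1](divff (expf_neq0 2 N0)) expr_div_n -mulrBl.
  rewrite (_ : _ - _ = area P ^+ 2); last first.
    by rewrite exprMn !euclid_norm_sqr -lagrange -areaE; ring.
  rewrite -expr_div_n sqrtr_sqr normrM normfV [X in _ / X]ger0_norm //.
  by rewrite mulr_ge0 // sqrtr_ge0.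
rewrite cosE !sinE /foot !I3_arith.
rewrite -euclid_norm_sqr -/(n _ _) (nC i (i + 2)) (nC (i + 1) (i + 2)) (nC i (i + 1)).
have -> : dot (P i - P (i + 2)) (P (i + 1) - P (i + 2)) =
    dot (P (i + 2) - P i) (P (i + 2) - P (i + 1)).
  by rewrite !dotE !mxE; ring.
field; rewrite !n0 ?normr_eq0 ?P0 ?I3_neq //.
all: by rewrite eq_sym I3_neq.
Qed.

Definition is_rat (x : R) : Prop := range (@ratr R) x.

Lemma is_ratM x y : is_rat x -> is_rat y -> is_rat (x * y).
Proof. by move=> [p _ <-] [q _ <-]; exists (p * q) => //; rewrite rmorphM. Qed.

Lemma is_ratV x : is_rat x -> is_rat x^-1.
Proof. by move=> [p _ <-]; exists p^-1 => //; rewrite fmorphV. Qed.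

Lemma is_ratD x y : is_rat x -> is_rat y -> is_rat (x + y).
Proof. by move=> [p _ <-] [q _ <-]; exists (p + q) => //; rewrite rmorphD. Qed.

Lemma is_ratN x : is_rat x -> is_rat (- x).
Proof. by move=> [p _ <-]; exists (- p) => //; rewrite rmorphN. Qed.

Lemma common_denominator (f : 'I_3 -> R) : (forall i, is_rat (f i)) ->
  exists D : nat, (0 < D)%N /\ forall i, D%:R * (2 * f i) \is a Num.int.
Proof.
move=> H; have H' i : exists x, ratr x = f i by have [x _ E] := H i; exists x.
have [q qE] := boolp.choice H'.
have dE i : `|denq (q i)|%N%:R * f i \is a Num.int.
  rewrite -qE -[X in X * _](_ : (denq (q i))%:~R = _); last first.
    by rewrite -[in LHS]absz_denq pmulrn.
  have -> : (denq (q i))%:~R * ratr (q i) = (numq (q i))%:~R :> R.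
    rewrite -[ratr _](_ : (numq (q i))%:~R / (denq (q i))%:~R = _); last by [].
    by rewrite mulrC divfK // intr_eq0 denq_eq0.
  exact: intr_int.
exists (\prod_i `|denq (q i)|%N)%N; split.
  by apply: prodn_gt0 => i; rewrite absz_gt0 denq_eq0.
move=> i; rewrite (bigD1 i) //= natrM.
set r := (\prod_(_ | _) _)%N.
have -> : `|denq (q i)|%N%:R * r%:R * (2 * f i) =
  r%:R * 2 * (`|denq (q i)|%N%:R * f i) by ring.
by apply: rpredM => //; apply: rpredM; apply: rpred_nat.
Qed.

Lemma trig_rational_pi (a b : R) : trig_rational a -> trig_rational b ->
  trig_rational (pi - a - b).
Proof.
move=> [sa ca] [sb cb]; rewrite -addrA -opprD /trig_rational sinB cosB.
rewrite sinpi cospi !mul0r !mulN1r sub0r opprK addr0 sinD cosD.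
split; last apply: is_ratN.
- by apply: is_ratD; apply: is_ratM.
- by apply: is_ratD; [|apply: is_ratN]; apply: is_ratM.
Qed.

Lemma foot_rational : (forall i, trig_rational (interior_angle P i)) ->
  forall i, is_rat (foot P i).
Proof.
move=> H i; rewrite foot_angles; apply: is_ratM; last by apply: is_ratV; case: (H i).
by apply: is_ratM; [case: (H (i + 2))|case: (H (i + 1))].
Qed.

Lemma complexity_le n :
  (combinatorial_complexity P n <= (size (diagonal_words P n) + 3)%:R%:E)%E.
Proof.
pose L := [seq [:: P i] | i <- enum 'I_3] ++
  [seq fold_word P w | w <- diagonal_words P n].
rewrite /combinatorial_complexity; set A := [set s | _]%classic.
have AL s : A s -> s \in L.
  move=> [[[i ->]|/(generalized_diagonal_word P0)[w [dw sw E]]] ls];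
    rewrite mem_cat; apply/orP; [left|right].
    by apply/mapP; exists i; rewrite ?mem_enum.
  apply/mapP; exists w => //; rewrite mem_diagonal_words dw sw; exact: ls.
have fA : finite_set A by apply: sub_finite_set (finite_seq L) => s /AL.
rewrite /counting asboolT // lee_fin ler_nat.
have <- : size L = (size (diagonal_words P n) + 3)%N.
  by rewrite size_cat 2!size_map size_enum_ord addnC.
apply: uniq_leq_size; first exact: finmap.fset_uniq.
move=> s; have E : (s \in finmap.enum_fset (fset_set A)) = (s \in A).
  exact: in_fset_set.
by rewrite E inE => /AL.
Qed.

End Triangle.

Lemma diagonal_words_mono (R : realType) (P : 'I_3 -> 'rV[R]_2) m n :
  (m <= n)%N -> (size (diagonal_words P m) <= size (diagonal_words P n))%N.
Proof.
move=> mn; apply: uniq_leq_size; first exact: uniq_diagonal_words.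
move=> w; rewrite !mem_diagonal_words => /andP[-> wm] /=.
exact: leq_trans mn.
Qed.

(** Iterated doubling multiplies factors [C * 2 ^ (8 * k)]. As [G] bounds [C], [2 ^ 8] and [f 1],
    each doubling adds [k + 1] to the exponent of [G], and [1 + k + (k + 1) ^ 2 <= (k + 2) ^ 2]. *)
Lemma quasipolynomial (f : nat -> nat) C :
  (forall m, (0 < m)%N -> (f m.*2 <= C * m ^ 8 * f m)%N) ->
  exists2 G, (0 < G)%N & forall k, (f (2 ^ k) <= G ^ (k.+1 ^ 2))%N.
Proof.
move=> H; exists (f 1%N + C + 2 ^ 8)%N; first by rewrite addn_gt0 expn_gt0 orbT.
set G := (_ + _ + _)%N; elim=> [|k IH].
  by rewrite expn0 exp1n expn1 /G -addnA leq_addr.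
have k0 : (0 < 2 ^ k)%N by rewrite expn_gt0.
have G0 : (0 < G)%N by rewrite /G addn_gt0 expn_gt0 orbT.
have -> : (2 ^ k.+1 = (2 ^ k).*2)%N by rewrite expnS mul2n.
apply: (leq_trans (H _ k0)).
apply: (@leq_trans (G * G ^ k * G ^ (k.+1 ^ 2))).
  apply: leq_mul IH; apply: leq_mul.
    by rewrite /G addnAC leq_addl.
  rewrite -expnM mulnC expnM; case: (posnP k) => [->//|k1].
  by rewrite leq_exp2r // /G leq_addl.
by rewrite -expnS -expnD leq_pexp2l //; nia.
Qed.

(** For [t >= 1] one has [t + 2 <= 3 * t]; the cubic term then dominates beyond [r] and the constant
    does below it. *)
Lemma quadratic_le_cubic (R : realFieldType) (g B : R) : 0 <= g -> 0 < B ->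
  exists2 c, 0 <= c & forall t : nat, t.+2%:R ^+ 2 * g <= c + B * t%:R ^+ 3.
Proof.
move=> g0 B0; pose r := 9 * g / B.
have r0 : 0 <= r by rewrite divr_ge0 ?mulr_ge0 // ltW.
have gr : 0 <= 9 * g * r ^+ 2.
  by apply: mulr_ge0; [apply: mulr_ge0|apply: exprn_ge0].
exists (4 * g + 9 * g * r ^+ 2) => [|t]; first by lra.
case: t => [|t].
  by rewrite expr0n /= mulr0 addr0 expr2; lra.
set x : R := t.+1%:R; have x1 : 1 <= x by rewrite ler1n.
have -> : t.+3%:R = x + 2 :> R by rewrite /x -!natr1; ring.
have h1 : (x + 2) ^+ 2 * g <= 9 * g * x ^+ 2.
  have -> : 9 * g * x ^+ 2 = (3 * x) ^+ 2 * g by ring.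
  by rewrite ler_wpM2r // lerXn2r ?nnegrE //; lra.
apply: (le_trans h1).
have [xr|rx] := lerP x r.
  have : 9 * g * x ^+ 2 <= 9 * g * r ^+ 2.
    by rewrite ler_wpM2l ?mulr_ge0 // lerXn2r ?nnegrE //; lra.
  have : 0 <= B * x ^+ 3 by rewrite mulr_ge0 ?exprn_ge0 ?(ltW B0) //; lra.
  lra.
have : 9 * g * x ^+ 2 <= B * x ^+ 3.
  have -> : 9 * g = B * r by rewrite /r [RHS]mulrC divfK // gt_eqF.
  rewrite -mulrA ler_wpM2l ?(ltW B0) // [leRHS]exprS ler_wpM2r ?exprn_ge0 ?ltW //; lra.
lra.
Qed.

(** For [2 ^ t < n], the power [n ^ eps] is at least [expR (3 * b * t)], hence at least
    [(b * t) ^ 3], which beats the quadratic exponent on the left. The 3 in [b] is this cube. *)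
Lemma quasipolynomial_weakly_exponential (R : realType) (G : nat) (eps : R) :
  (0 < G)%N -> 0 < eps -> exists2 C : R, 0 < C & forall n,
    (G ^ ((up_log 2 n).+1 ^ 2))%:R <= C * expR (n%:R `^ eps).
Proof.
move=> G0 eps0; have G0' : 0 < G%:R :> R by rewrite ltr0n.
have g0 : 0 <= ln (G%:R : R) by rewrite ln_ge0 // ler1n.
have l2 : 0 < ln (2 : R) by rewrite ln_gt0 // ltr1n.
pose b := eps * ln 2 / 3.
have b0 : 0 < b by rewrite !mulr_gt0.
have [c c0 H] := quadratic_le_cubic g0 (exprn_gt0 3 b0).
exists (G%:R * expR c) => [|n]; first by rewrite mulr_gt0 ?expR_gt0.
have ec : 1 <= expR c by apply: le_trans (expR_ge1Dx c); rewrite lerDl.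
have [n1|n1] := leqP n 1.
  have -> : up_log 2 n = 0%N by apply/eqP; rewrite up_log_eq0 n1 orbT.
  rewrite exp1n expn1 -mulrA -[leLHS]mulr1 ler_wpM2l ?ler0n //.
  rewrite mulr_ege1 //; apply: le_trans (expR_ge1Dx _); rewrite lerDl powR_ge0 //.
(* With [up_log 2 n = t + 1] one has [2 ^ t < n], and the exponent becomes [(t + 2) ^ 2]. *)
have [/andP[+ _]] := (up_log_bounds (isT : (1 < 2)%N) n1, tt).
have : (0 < up_log 2 n)%N by rewrite up_log_gt0.
case: (up_log 2 n) => // t _ /= tn.
rewrite natrX -[G%:R in leLHS]lnK ?posrE // -expRM_natl.
rewrite -mulrA -[leLHS]mul1r ler_pM ?expR_ge0 ?ler1n //.
rewrite -expRD ler_expR natrX.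
apply: le_trans (H t) _; rewrite lerD2l -exprMn.
have nn : 0 < n%:R :> R by rewrite ltr0n (leq_trans _ n1).
have tl : t%:R * ln (2 : R) <= ln n%:R.
  by rewrite mulr_natl -lnXn // ler_ln ?posrE ?exprn_gt0 // -natrX ler_nat ltnW.
rewrite /powR gt_eqF //.
apply: (@le_trans _ _ (expR (b * t%:R) ^+ 3)).
  have bt : 0 <= b * t%:R by apply: mulr_ge0; rewrite ?ler0n ?(ltW b0).
  rewrite lerXn2r ?nnegrE ?expR_ge0 //.
  by apply: le_trans (expR_ge1Dx _); rewrite lerDr.
rewrite -expRM_natl ler_expR /b.
have -> : 3%:R * (eps * ln 2 / 3 * t%:R) = eps * (t%:R * ln 2) :> R by field.
by rewrite ler_wpM2l // ltW.
Qed.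

Theorem corollary2p6 (R : realType) (alpha beta : R) (P : 'I_3 -> 'rV[R]_2)
  (alpha_gt0 : 0 < alpha) (beta_gt0 : 0 < beta)
  (alpha_beta_lt_pi : alpha + beta < pi)
  (alpha_rational : trig_rational alpha) (beta_rational : trig_rational beta)
  (P_angles : has_angles P alpha beta (pi - alpha - beta)) :
  weakly_exponential (combinatorial_complexity P).
Proof.
have [nd A0 A1 A2] := P_angles.
have P0 := nondegenerate_area nd.
have rat i : trig_rational (interior_angle P i).
  have [->|->|->] := I3_cases 0 i; rewrite ?add0r.
  - by rewrite A0.
  - by rewrite A1.
  - by rewrite A2; apply: trig_rational_pi.
have [D [D0 DE]] := common_denominator (foot_rational P0 rat).
have [C HC] := size_diagonal_words_double P0 D0 DE.
have [G G0 HG] := quasipolynomial HC.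
move=> eps eps0.
have [C' C'0 HC'] := quasipolynomial_weakly_exponential G0 eps0.
exists C' => // n; apply: le_lt_trans (complexity_le P0 n) _.
rewrite lte_fin; apply: lt_le_trans (HC' n).
rewrite ltr_nat; apply: leq_trans (HG _).
(* The 3 vertices are fewer than the 9 of the recursion, which makes the inequality strict. *)
rewrite -addnS; apply: leq_add => //.
apply: diagonal_words_mono; exact: up_logP.
Qed.
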